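(* Let $((F,\nu,N),[\cdot,\cdot]_{F,h},(\rho,\eta))$ be a generalized Lie algebroid, $(E,\pi,M)$ a vector bundle with dual $(E^*,\overset{*}{\pi},M)$, and $(\overset{*}{g},h)$ a locally invertible vector bundle morphism from $(E^*,\overset{*}{\pi},M)$ to $(F,\nu,N)$. For all $\overset{*}{u},\overset{*}{v}\in\Gamma(E^*,\overset{*}{\pi},M)$ the vertical lifts and complete $(\overset{*}{g},h)$-lifts satisfy: (i) $[\overset{*}{u}{}^V,\overset{*}{v}{}^V]_{(\rho,\eta)TE^*}=0$; (ii) $[\overset{*}{u}{}^V,\overset{*}{v}{}^C]_{(\rho,\eta)TE^*}=\{\Gamma(\overset{*}{g}{}^{-1},h^{-1})[\Gamma(\overset{*}{g},h)\overset{*}{u},\Gamma(\overset{*}{g},h)\overset{*}{v}]_{F,h}\}^V$; (iii) $[\overset{*}{u}{}^C,\overset{*}{v}{}^C]_{(\rho,\eta)TE^*}=\{\Gamma(\overset{*}{g}{}^{-1},h^{-1})[\Gamma(\overset{*}{g},h)\overset{*}{u},\Gamma(\overset{*}{g},h)\overset{*}{v}]_{F,h}\}^C$.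
   Context: All objects are smooth; $\mathcal F(M)=C^\infty(M)$; $\Gamma(E,\pi,M)$ denotes the sections of $(E,\pi,M)$; repeated indices are summed. Generalized Lie algebroid: $M,N$ are $m$-dimensional manifolds, $h:M\to N$ and $\eta:N\to M$ are diffeomorphisms, $(F,\nu,N)$ is a vector bundle, $(\rho,\eta)$ is a vector bundle morphism from $(F,\nu,N)$ to $(TM,\tau_M,M)$ ($\rho$ covers $\eta$), and $[\cdot,\cdot]_{F,h}$ is a Lie bracket on $\Gamma(F,\nu,N)$ with $[z,f w]_{F,h}=f[z,w]_{F,h}+\big(\Gamma(Th\circ\rho,h\circ\eta)(z)f\big)w$ for $f\in\mathcal F(N)$. Here, for a local frame $(t_\alpha)$ of $F$, local coordinates $(x^i)$ on $M$, and $\rho_\alpha^i$ the local component functions of $\rho$ (functions on $N$), $\Gamma(Th\circ\rho,h\circ\eta)(z)$ is the vector field on $N$ acting on $f\in\mathcal F(N)$ by $\Gamma(Th\circ\rho,h\circ\eta)(z^\alpha t_\alpha)(f)=z^\alpha\rho^i_\alpha\,\big(\tfrac{\partial(f\circ h)}{\partial x^i}\circ h^{-1}\big)$ (understood to be globally well defined); $z\mapsto\Gamma(Th\circ\rho,h\circ\eta)(z)$ is a Lie algebra morphism to vector fields on $N$. Structure functions: $[t_\alpha,t_\beta]_{F,h}=L^\gamma_{\alpha\beta}t_\gamma$. $E$ has rank $r$, local frame $(s_a)$; $E^*$ has dual frame $(s^a)$, local coordinates $(x^i,p_a)$, coordinate vector fields $\overset{*}{\partial}_i,\dot\partial^a$.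 $(\overset{*}{g},h)$ is a vector bundle morphism $E^*\to F$ covering $h$ with components $g^{\alpha b}$ (local functions on $M$), locally invertible: on each chart there are functions $\tilde g_{b\alpha}$ with $\tilde g_{b\alpha}g^{\alpha a}=\delta^a_b$ and $g^{\alpha a}\tilde g_{a\beta}=\delta^\alpha_\beta$. $\Gamma(\overset{*}{g},h)(u_as^a)=((g^{\alpha a}u_a)\circ h^{-1})t_\alpha$, with inverse $\Gamma(\overset{*}{g}{}^{-1},h^{-1})(z^\alpha t_\alpha)=\tilde g_{b\alpha}(z^\alpha\circ h)s^b$. Generalized tangent bundle $(\rho,\eta)TE^*$: with $\overset{*}{T}_\alpha$ the frame of $(h\circ\overset{*}{\pi})^*F$ induced by $t_\alpha$, it is the subbundle of $(h\circ\overset{*}{\pi})^*F\oplus TE^*$ over $E^*$ with local frame $\overset{*}{\tilde\partial}_\alpha=\overset{*}{T}_\alpha\oplus(\rho^i_\alpha\circ h\circ\overset{*}{\pi})\overset{*}{\partial}_i$, $\dot{\tilde\partial}{}^a=0\oplus\dot\partial^a$. Its anchor is $X^\alpha\overset{*}{\tilde\partial}_\alpha+\tilde X_a\dot{\tilde\partial}{}^a\mapsto X^\alpha(\rho^i_\alpha\circ h\circ\overset{*}{\pi})\overset{*}{\partial}_i+\tilde X_a\dot\partial^a$, and $[\cdot,\cdot]_{(\rho,\eta)TE^*}$ is the Lie algebroid bracket with this anchor determined by $[\overset{*}{\tilde\partial}_\alpha,\overset{*}{\tilde\partial}_\beta]=(L^\gamma_{\alpha\beta}\circ h\circ\overset{*}{\pi})\overset{*}{\tilde\partial}_\gamma$,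 $[\overset{*}{\tilde\partial}_\alpha,\dot{\tilde\partial}{}^b]=0$, $[\dot{\tilde\partial}{}^a,\dot{\tilde\partial}{}^b]=0$ and the Leibniz rule. Lifts: for $\overset{*}{u}=u_as^a$ define $K^{\gamma a}(\overset{*}{u})$ by $[\Gamma(\overset{*}{g},h)\overset{*}{u},\Gamma(\overset{*}{g},h)s^a]_{F,h}=K^{\gamma a}(\overset{*}{u})t_\gamma$. Then $\overset{*}{u}{}^V=(u_a\circ\overset{*}{\pi})\dot{\tilde\partial}{}^a$ and $$\overset{*}{u}{}^C=((g^{\alpha e}u_e)\circ\overset{*}{\pi})\overset{*}{\tilde\partial}_\alpha-p_a(K^{\gamma a}(\overset{*}{u})\circ h\circ\overset{*}{\pi})(\tilde g_{b\gamma}\circ\overset{*}{\pi})\dot{\tilde\partial}{}^b.$$ *)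

(* Defs.v *)
From HB Require Import structures.
From mathcomp Require Import all_boot all_order all_algebra.
From mathcomp Require Import all_classical all_reals all_analysis.

Set Implicit Arguments.
Unset Strict Implicit.
Unset Printing Implicit Defensive.

Import Order.TTheory GRing.Theory Num.Theory.
Import numFieldNormedType.Exports.

Local Open Scope classical_set_scope.
Local Open Scope ring_scope.

Fixpoint Ck (R : realType) (n k : nat) (U : set 'rV[R]_n) (f : 'rV[R]_n -> R)
    : Prop :=
  if k is k'.+1 then
    (forall x, U x -> differentiable f x) /\
    (forall i : 'I_n, Ck k' U (fun x => 'D_(delta_mx 0 i) f x))
  else forall x, U x -> {for x, continuous f}.

Definition smooth_on (R : realType) (n : nat) (U : set 'rV[R]_n)
  (f : 'rV[R]_n -> R) : Prop := forall k, Ck k U f.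

(* Only the restriction of [cmap] to [cdom] and of [cinv] to the image of
   [cdom] under [cmap] are meaningful. *)
Record chart (R : realType) (T : Type) (n : nat) := Chart {
  cdom : set T;
  cmap : T -> 'rV[R]_n;
  cinv : 'rV[R]_n -> T }.

(* The topology is the one induced by the atlas, see [mopen].  [chart_at p] is
   a reference chart around [p], used to represent tangent vectors at [p]. *)
Record charted (R : realType) (n : nat) := Charted {
  carrier :> Type;
  atlas : set (chart R carrier n);
  chart_at : carrier -> chart R carrier n }.

Definition mopen (R : realType) (n : nat) (M : charted R n) (U : set M) : Prop :=
  forall c, atlas c -> open (cmap c @` (U `&` cdom c)).

Definition smooth_fun (R : realType) (n : nat) (M : charted R n) (U : set M)
    (f : M -> R) : Prop :=
  forall c, atlas c ->
    smooth_on (cmap c @` (U `&` cdom c)) (fun v => f (cinv c v)).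

(* Given the other conditions, second countability of the induced topology
   amounts to the existence of a countable subatlas. *)
Record is_manifold (R : realType) (n : nat) (M : charted R n) : Prop := {
  chart_atP : forall p : M, atlas (chart_at p) /\ cdom (chart_at p) p;
  chartK : forall c : chart R M n, atlas c ->
    forall p, cdom c p -> cinv c (cmap c p) = p;
  chart_overlap : forall c d : chart R M n, atlas c -> atlas d ->
    open (cmap c @` (cdom c `&` cdom d)) /\
    forall i, smooth_on (cmap c @` (cdom c `&` cdom d))
                        (fun v => cmap d (cinv c v) 0 i);
  manifold_hausdorff : forall p q : M, p <> q -> exists U V : set M,
    [/\ mopen U, mopen V, U p, V q & U `&` V = set0];
  manifold_countable : exists A : set (chart R M n),
    [/\ countable A, A `<=` @atlas R n M &
        forall p : M, exists2 c, A c & cdom c p] }.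

Definition smooth_map (R : realType) (m n : nat) (M : charted R m)
    (N : charted R n) (f : M -> N) : Prop :=
  (forall V, mopen V -> mopen (f @^-1` V)) /\
  (forall c d, atlas c -> atlas d -> forall i,
     smooth_on (cmap c @` (cdom c `&` f @^-1` cdom d))
               (fun v => cmap d (f (cinv c v)) 0 i)).

Record diffeo (R : realType) (m n : nat) (M : charted R m) (N : charted R n) :=
  Diffeo {
    dfun :> M -> N;
    dinv : N -> M;
    dfunK : cancel dfun dinv;
    dinvK : cancel dinv dfun;
    dfun_smooth : smooth_map dfun;
    dinv_smooth : smooth_map dinv }.

(* A tangent vector at [p] is given by its components in [chart_at p]. *)
Definition tangent (R : realType) (n : nat) (M : charted R n) (p : M) :=
  'rV[R]_n.

Definition tact (R : realType) (n : nat) (M : charted R n) (p : M)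
    (X : tangent p) (f : M -> R) : R :=
  'D_(X : 'rV[R]_n) (fun v => f (cinv (chart_at p) v)) (cmap (chart_at p) p).

Definition pderiv (R : realType) (n : nat) (M : charted R n)
    (c : chart R M n) (i : 'I_n) (f : M -> R) (p : M) : R :=
  'D_(delta_mx 0 i : 'rV[R]_n) (fun v => f (cinv c v)) (cmap c p).

Definition coordv (R : realType) (n : nat) (M : charted R n)
    (c : chart R M n) (i : 'I_n) (p : M) : tangent p :=
  'D_(delta_mx 0 i : 'rV[R]_n) (fun v => cmap (chart_at p) (cinv c v))
     (cmap c p).

(* Only the restriction of [fvec] to [fdom] is meaningful. *)
Record lframe (R : realType) (T : Type) (W : T -> vectType R) (k : nat) :=
  LFrame {
    fdom : set T;
    fvec :> forall x, k.-tuple (W x) }.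

Record bundle (R : realType) (n : nat) (M : charted R n) (k : nat) := Bundle {
  fib :> M -> vectType R;
  frames : set (lframe fib k);
  frame_at : M -> lframe fib k }.

Definition fr (R : realType) (T : Type) (W : T -> vectType R) (k : nat)
  (s : lframe W k) (a : 'I_k) (x : T) : W x := tnth (s x) a.

Definition comp (R : realType) (T : Type) (W : T -> vectType R) (k : nat)
  (s : lframe W k) (a : 'I_k) (x : T) (w : W x) : R := coord (s x) a w.

Record is_vector_bundle (R : realType) (n : nat) (M : charted R n) (k : nat)
    (E : bundle M k) : Prop := {
  frame_atP : forall x : M, frames (frame_at E x) /\ fdom (frame_at E x) x;
  frame_open : forall s : lframe E k, frames s -> mopen (fdom s);
  frame_basis : forall s : lframe E k, frames s ->
    forall x, fdom s x -> basis_of fullv (s x);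
  frame_smooth : forall s t : lframe E k, frames s -> frames t -> forall a b,
    smooth_fun (fdom s `&` fdom t) (fun x => comp t b (fr s a x)) }.

Definition sect (R : realType) (n : nat) (M : charted R n) (k : nat)
  (E : bundle M k) : Type := forall x : M, E x.

(* [u] is a section over [U]; its values outside [U] are irrelevant. *)
Definition smooth_sect (R : realType) (n : nat) (M : charted R n) (k : nat)
    (E : bundle M k) (U : set M) (u : sect E) : Prop :=
  forall s : lframe E k, frames s -> forall a,
    smooth_fun (U `&` fdom s) (fun x => comp s a (u x)).

Record bmorphism (R : realType) (m n : nat) (M : charted R m) (N : charted R n)
    (k l : nat) (phi : M -> N) (E : bundle M k) (F : bundle N l) := BMorphism {
  bmor :> forall x : M, 'Hom(E x, F (phi x));
  bmor_smooth : forall (s : lframe E k) (t : lframe F l), frames s -> frames t ->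
    forall a b, smooth_fun (fdom s `&` phi @^-1` fdom t)
                           (fun x => comp t b (bmor x (fr s a x))) }.

Definition coord_frame (R : realType) (n : nat) (M : charted R n)
    (c : chart R M n) : lframe (fun _ : M => 'rV[R]_n : vectType R) n :=
  LFrame (W := fun _ : M => 'rV[R]_n : vectType R) (cdom c)
         (fun p => [tuple coordv c i p | i < n]).

Definition tangent_bundle (R : realType) (n : nat) (M : charted R n) :
    bundle M n :=
  @Bundle R n M n (fun _ => 'rV[R]_n : vectType R)
    [set coord_frame c | c in @atlas R n M]
    (fun p => coord_frame (chart_at p)).

Definition dual_fib (R : realType) (T : Type) (W : T -> vectType R) (x : T) :
  vectType R := 'Hom(W x, R^o).

Definition dual_frame (R : realType) (T : Type) (W : T -> vectType R) (k : nat)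
    (s : lframe W k) : lframe (dual_fib W) k :=
  @LFrame R T (dual_fib W) k (fdom s)
    (fun x => [tuple linfun (coord (s x) a : W x -> R^o) | a < k]).

Definition dual (R : realType) (n : nat) (M : charted R n) (k : nat)
    (E : bundle M k) : bundle M k :=
  @Bundle R n M k (dual_fib E) [set dual_frame s | s in @frames R n M k E]
    (fun x => dual_frame (frame_at E x)).

Definition dtot (R : realType) (n : nat) (M : charted R n) (k : nat)
  (E : bundle M k) : Type := {x : M & dual_fib E x}.

(* Coordinates (x^i, p_a) on E^*, where p_a is the pairing with the [a]-th
   element of the frame [s] of E. *)
Definition dchart (R : realType) (n : nat) (M : charted R n) (k : nat)
    (E : bundle M k) (c : chart R M n) (s : lframe E k) :
    chart R (dtot E) (n + k) :=
  @Chart R (dtot E) (n + k)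
    [set e | cdom c (tag e) /\ fdom s (tag e)]
    (fun e => row_mx (cmap c (tag e)) (\row_a (tagged e (fr s a (tag e)) : R)))
    (fun v => Tagged (dual_fib E)
       (\sum_a rsubmx v 0 a *: fr (dual_frame s) a (cinv c (lsubmx v)))).

Definition dual_total (R : realType) (n : nat) (M : charted R n) (k : nat)
    (E : bundle M k) : charted R (n + k) :=
  @Charted R (n + k) (dtot E)
    [set d | exists (c : chart R M n) (s : lframe E k),
             [/\ atlas c, frames s & d = dchart c s]]
    (fun e => dchart (chart_at (tag e)) (frame_at E (tag e))).

Definition dproj (R : realType) (n : nat) (M : charted R n) (k : nat)
  (E : bundle M k) (e : dual_total E) : M := tag (e : dtot E).

(* p_a *)
Definition pcoord (R : realType) (n : nat) (M : charted R n) (k : nat)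
    (E : bundle M k) (s : lframe E k) (a : 'I_k) (e : dual_total E) : R :=
  tagged (e : dtot E) (fr s a (dproj e)).

Definition fsect (R : realType) (T : Type) (W : T -> lmodType R) : Type :=
  forall x : T, W x.

(* A Lie algebroid bracket acts on local sections: [sec V z] says that [z] is
   (smooth and) a section over [V], and for each open [V] the operation [b]
   induces a Lie bracket on the sections over [V], compatibly with restriction;
   values outside [V] are irrelevant.  [V = setT] gives the bracket of global
   sections.  [act] is the action of sections on functions via the anchor. *)
Record is_algebroid_bracket (R : realType) (n : nat) (X : charted R n)
    (W : X -> lmodType R) (sec : set X -> fsect W -> Prop)
    (act : fsect W -> (X -> R) -> X -> R)
    (b : fsect W -> fsect W -> fsect W) : Prop := {
  br_sec : forall V z w, mopen V -> sec V z -> sec V w -> sec V (b z w);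
  br_restr : forall V z z' w w', mopen V ->
    sec V z -> sec V z' -> sec V w -> sec V w' ->
    (forall x, V x -> z x = z' x) -> (forall x, V x -> w x = w' x) ->
    forall x, V x -> b z w x = b z' w' x;
  br_add : forall V z z' w, mopen V -> sec V z -> sec V z' -> sec V w ->
    forall x, V x -> b (fun y => z y + z' y) w x = b z w x + b z' w x;
  br_scale : forall V (a : R) z w, mopen V -> sec V z -> sec V w ->
    forall x, V x -> b (fun y => a *: z y) w x = a *: b z w x;
  br_anti : forall V z w, mopen V -> sec V z -> sec V w ->
    forall x, V x -> b z w x = - b w z x;
  br_jacobi : forall V z w v, mopen V -> sec V z -> sec V w -> sec V v ->
    forall x, V x -> b z (b w v) x + b w (b v z) x + b v (b z w) x = 0;
  br_leibniz : forall V (f : X -> R) z w, mopen V -> smooth_fun V f ->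
    sec V z -> sec V w ->
    forall x, V x -> b z (fun y => f y *: w y) x = f x *: b z w x + act z f x *: w x;
  br_anchor : forall V (f : X -> R) z w, mopen V -> smooth_fun V f ->
    sec V z -> sec V w ->
    forall x, V x -> act (b z w) f x = act z (act w f) x - act w (act z f) x }.

(* [ganchor] is the bundle map underlying [z |-> Gamma(Th o rho, h o eta)(z)].
   Its coordinate expression evaluates the components of [grho] at [geta y] and
   the coordinate derivations at [h^-1 y] in one and the same chart of M, hence
   the choice, for each [y], of a chart [gchart y] containing both points.
   Global well-definedness is [ganchorE]: all charts and frames give the same
   vector field on N. *)
Record gen_lie_algebroid (R : realType) (m p : nat) (M N : charted R m) :=
  GenLieAlgebroid {
    gh : diffeo M N;
    geta : diffeo N M;
    gF : bundle N p;
    gF_bundle : is_vector_bundle gF;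
    grho : bmorphism geta gF (tangent_bundle M);
    gchart : N -> chart R M m;
    gchartP : forall y,
      [/\ atlas (gchart y), cdom (gchart y) (geta y) &
          cdom (gchart y) (dinv gh y)];
    ganchor : forall y : N, gF y -> tangent y;
    ganchorE : forall (c : chart R M m) (t : lframe gF p) (y : N)
        (w : gF y) (V : set N) (f : N -> R),
      atlas c -> frames t -> fdom t y ->
      cdom c (geta y) -> cdom c (dinv gh y) ->
      mopen V -> V y -> smooth_fun V f ->
      tact (ganchor w) f =
      \sum_(al < p) \sum_(i < m)
         comp t al w * @comp R M (tangent_bundle M) m (coord_frame c) i (geta y)
                           (grho y (fr t al y)) *
         pderiv c i (fun x => f (gh x)) (dinv gh y);
    gbr : sect gF -> sect gF -> sect gF;
    gbrP : is_algebroid_bracket (W := fun y => gF y) (@smooth_sect R m N p gF)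
             (fun z f y => tact (ganchor (z y)) f) gbr }.

(* The component function rho^i_alpha on N. *)
Definition rho_comp (R : realType) (m p : nat) (M N : charted R m)
    (G : gen_lie_algebroid p M N) (c : chart R M m) (t : lframe (gF G) p)
    (al : 'I_p) (i : 'I_m) (y : N) : R :=
  @comp R M (tangent_bundle M) m (coord_frame c) i (geta G y)
    (grho G y (fr t al y)).

Definition struct_fun (R : realType) (m p : nat) (M N : charted R m)
    (G : gen_lie_algebroid p M N) (t : lframe (gF G) p)
    (al be ga : 'I_p) (y : N) : R :=
  comp t ga (gbr (fr t al) (fr t be) y).

Definition locally_invertible (R : realType) (m n k l : nat) (M : charted R m)
    (N : charted R n) (h : M -> N) (E : bundle M k) (F : bundle N l)
    (g : bmorphism h (dual E) F) : Prop :=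
  forall (s : lframe E k) (t : lframe F l), frames s -> frames t ->
  exists gt : 'I_k -> 'I_l -> M -> R,
    (forall b al, smooth_fun (fdom s `&` h @^-1` fdom t) (gt b al)) /\
    forall x, fdom s x -> fdom t (h x) ->
      let gc al a := comp t al (g x (fr (dual_frame s) a x)) in
      (forall b a, \sum_al gt b al x * gc al a = (b == a)%:R) /\
      (forall al be, \sum_a gc al a * gt a be x = (al == be)%:R).

(* Gamma(g, h): the value at [y] is [g] at [h^-1 y], transported from the fibre
   over [h (h^-1 y)] to the fibre over [y]. *)
Definition gsec (R : realType) (m n k l : nat) (M : charted R m)
    (N : charted R n) (h : diffeo M N) (E : bundle M k) (F : bundle N l)
    (g : bmorphism h (dual E) F) (u : sect (dual E)) : sect F :=
  fun y => ecast y' (F y') (dinvK h y) (g (dinv h y) (u (dinv h y))).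

(* Gamma(g^-1, h^-1) *)
Definition gsec_inv (R : realType) (m n k l : nat) (M : charted R m)
    (N : charted R n) (h : diffeo M N) (E : bundle M k) (F : bundle N l)
    (g : bmorphism h (dual E) F) (z : sect F) : sect (dual E) :=
  fun x => ((g x)^-1)%VF (z (h x)).

(* The fibres of the Whitney sum (h o pi)^* F (+) TE^*. *)
Definition gt_fib (R : realType) (m p r : nat) (M N : charted R m)
    (G : gen_lie_algebroid p M N) (E : bundle M r) (e : dual_total E) :
    lmodType R :=
  (gF G (gh G (dproj e)) * 'rV[R]_(m + r))%type.

Definition admissible (R : realType) (m p r : nat) (M N : charted R m)
    (G : gen_lie_algebroid p M N) (E : bundle M r)
    (c : chart R M m) (s : lframe E r) (t : lframe (gF G) p) : Prop :=
  [/\ atlas c, frames s & frames t].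

(* [c] expresses both the components of [grho], at [geta (gh x)], and the
   coordinate vector fields at x, so its domain has to contain both points. *)
Definition gt_dom (R : realType) (m p r : nat) (M N : charted R m)
    (G : gen_lie_algebroid p M N) (E : bundle M r)
    (c : chart R M m) (s : lframe E r) (t : lframe (gF G) p) :
    set (dual_total E) :=
  [set e | [/\ cdom c (dproj e), cdom c (geta G (gh G (dproj e))),
               fdom s (dproj e) & fdom t (gh G (dproj e))]].

Definition gt_hor (R : realType) (m p r : nat) (M N : charted R m)
    (G : gen_lie_algebroid p M N) (E : bundle M r)
    (c : chart R M m) (s : lframe E r) (t : lframe (gF G) p)
    (al : 'I_p) : fsect (@gt_fib R m p r M N G E) :=
  fun e => (fr t al (gh G (dproj e)),
            \sum_(i < m) rho_comp c t al i (gh G (dproj e)) *: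
                         coordv (M := dual_total E) (dchart c s) (lshift r i) e).

Definition gt_ver (R : realType) (m p r : nat) (M N : charted R m)
    (G : gen_lie_algebroid p M N) (E : bundle M r)
    (c : chart R M m) (s : lframe E r)
    (a : 'I_r) : fsect (@gt_fib R m p r M N G E) :=
  fun e => (0, coordv (M := dual_total E) (dchart c s) (rshift m a) e).

(* Sections over [V] of the subbundle spanned by the local frames: around each
   point of [V], a smooth combination of some local frame. *)
Definition gt_sect (R : realType) (m p r : nat) (M N : charted R m)
    (G : gen_lie_algebroid p M N) (E : bundle M r) (V : set (dual_total E))
    (X : fsect (@gt_fib R m p r M N G E)) : Prop :=
  forall e, V e -> exists c s t (O : set (dual_total E))
      (x : 'I_p -> dual_total E -> R) (xv : 'I_r -> dual_total E -> R),
    [/\ admissible (G := G) c s t, mopen O, O e & O `<=` gt_dom c s t] /\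
    [/\ forall al, smooth_fun O (x al), forall a, smooth_fun O (xv a) &
        forall e', O e' ->
          X e' = \sum_al x al e' *: gt_hor c s t al e' +
                 \sum_a xv a e' *: gt_ver G c s a e'].

(* On the frame [gt_hor], [gt_ver], the anchor is the second projection. *)
Definition gt_act (R : realType) (m p r : nat) (M N : charted R m)
    (G : gen_lie_algebroid p M N) (E : bundle M r)
    (X : fsect (@gt_fib R m p r M N G E)) (f : dual_total E -> R)
    (e : dual_total E) : R :=
  tact (M := dual_total E) (p := e) (X e).2 f.

Record is_gt_bracket (R : realType) (m p r : nat) (M N : charted R m)
    (G : gen_lie_algebroid p M N) (E : bundle M r)
    (B : fsect (@gt_fib R m p r M N G E) -> fsect (@gt_fib R m p r M N G E) ->
         fsect (@gt_fib R m p r M N G E)) : Prop := {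
  gt_bracketP : is_algebroid_bracket (@gt_sect R m p r M N G E)
                  (@gt_act R m p r M N G E) B;
  gt_bracket_hh : forall c s t, admissible c s t -> forall al be e,
    gt_dom c s t e ->
    B (gt_hor c s t al) (gt_hor c s t be) e =
    \sum_ga struct_fun t al be ga (gh G (dproj e)) *: gt_hor c s t ga e;
  gt_bracket_hv : forall c s t, admissible c s t -> forall al b e,
    gt_dom c s t e -> B (gt_hor c s t al) (gt_ver G c s b) e = 0;
  gt_bracket_vv : forall c s t, admissible (G := G) c s t -> forall a b e,
    gt_dom c s t e -> B (gt_ver G c s a) (gt_ver G c s b) e = 0 }.

Definition vlift_loc (R : realType) (m p r : nat) (M N : charted R m)
    (G : gen_lie_algebroid p M N) (E : bundle M r)
    (c : chart R M m) (s : lframe E r) (u : sect (dual E)) :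
    fsect (@gt_fib R m p r M N G E) :=
  fun e => \sum_a comp (dual_frame s) a (u (dproj e)) *: gt_ver G c s a e.

(* K^(gamma a)(u), a function on N *)
Definition Kcoef (R : realType) (m p r : nat) (M N : charted R m)
    (G : gen_lie_algebroid p M N) (E : bundle M r)
    (g : bmorphism (gh G) (dual E) (gF G)) (s : lframe E r)
    (t : lframe (gF G) p) (u : sect (dual E)) (ga : 'I_p) (a : 'I_r) (y : N) : R :=
  comp t ga (gbr (gsec g u) (gsec g (fr (dual_frame s) a)) y).

Definition clift_loc (R : realType) (m p r : nat) (M N : charted R m)
    (G : gen_lie_algebroid p M N) (E : bundle M r)
    (g : bmorphism (gh G) (dual E) (gF G))
    (c : chart R M m) (s : lframe E r) (t : lframe (gF G) p)
    (u : sect (dual E)) : fsect (@gt_fib R m p r M N G E) :=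
  fun e => let x := dproj e in
    \sum_(al < p) (\sum_(a < r) comp t al (g x (fr (dual_frame s) a x)) *
                             comp (dual_frame s) a (u x)) *: gt_hor c s t al e
    - \sum_(b < r) (\sum_(a < r) \sum_(ga < p)
         pcoord s a e * Kcoef g s t u ga a (gh G x) *
         comp (dual_frame s) b (((g x)^-1)%VF (fr t ga (gh G x)))) *:
        gt_ver G c s b e.

(* The lifts do not depend on the local data used; at [e] they are evaluated
   with reference data around the base point of [e]. *)
Definition vlift (R : realType) (m p r : nat) (M N : charted R m)
    (G : gen_lie_algebroid p M N) (E : bundle M r) (u : sect (dual E)) :
    fsect (@gt_fib R m p r M N G E) :=
  fun e => vlift_loc G (gchart G (gh G (dproj e))) (frame_at E (dproj e)) u e.

Definition clift (R : realType) (m p r : nat) (M N : charted R m)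
    (G : gen_lie_algebroid p M N) (E : bundle M r)
    (g : bmorphism (gh G) (dual E) (gF G)) (u : sect (dual E)) :
    fsect (@gt_fib R m p r M N G E) :=
  fun e => clift_loc g (gchart G (gh G (dproj e))) (frame_at E (dproj e))
             (frame_at (gF G) (gh G (dproj e))) u e.

(* Main.v *)
From HB Require Import structures.
From mathcomp Require Import all_boot all_order all_algebra.
From mathcomp Require Import all_classical all_reals all_analysis.

Require Import Defs.

Import Order.TTheory GRing.Theory Num.Theory.
Import numFieldNormedType.Exports.

Set Implicit Arguments.
Unset Strict Implicit.
Unset Printing Implicit Defensive.

Local Open Scope classical_set_scope.
Local Open Scope ring_scope.

(** Why the theorem is true.  The isomorphism [g] carries the bracket of [F]
    over to [E^*]: with [ebr u v := g^-1 [g u, g v]] and the anchor of [F] read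
    on [M] through [h], the bundle [E^*] is a Lie algebroid over [M]
    ([dual_bracketP]).  In these terms the complete lift of [u] is the field on
    the total space of [E^*] that lies over [g u] and whose vertical part is
    linear on the fibres, namely the one attached to the derivation [ebr u]: its
    vertical components are [- \sum_a p_a * ebr_coef s u a b], where
    [ebr_coef s u] is the matrix of [ebr u] in the dual frame of [s].  Then (i)
    says that vertical fields constant on the fibres commute, (ii) that the
    bracket of a vertical lift with such a linear field is, up to sign, the
    vertical lift of the derivative of the section, and (iii) is the Jacobi
    identity for [u], [v] and the elements of the dual frame.

    To compute, one fixes a point of [E^*] and local data [c], [s], [t] around
    it.  Every section met here has the form [gt_field c s t z xi], lying over a
    section [z] of [F] and with vertical components [xi].  The Leibniz rule and
    the brackets of frame elements give ([gt_bracket_field])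
      [gt_field z xi, gt_field w zeta] = gt_field [z, w] (X zeta - Y xi),
    with [X] and [Y] the two fields.  The anchor of [gt_field z xi] acts on
    functions coming from [M] as the anchor of [z], and sends the fibre
    coordinate [p_a] to [xi a] ([gt_act_field_base], [gt_act_field_pcoord]), so
    that the vertical components in (i)-(iii) are explicit.

    The lifts of the theorem are evaluated at each point with data depending on
    that point, whereas the bracket depends on germs.  Hence it has to be shown
    that near a point the lifts are given by one and the same local expression
    ([vlift_field], [clift_field]).  A tangent vector of the total space is
    determined by its action on functions coming from [M] and on the fibre
    coordinates of one frame ([dual_tangent_eq]); under a change of frame this
    action transforms by the product rule, which matches the Leibniz rule for
    [ebr u] ([clift_coef_change]).

    All this rests on elementary calculus of the classes [Ck]: closure under
    sums, products and composition, and the chain rule in charts. *)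

(** * Functions of class C^k on open sets *)

Section calculus.
Variable R : realType.

(** The differential is defined by a choice, so that it has to be recognized as
    the differential of [g] from the expansion of [f] at [a]. *)
Lemma near_eq_differentiable (V W : normedModType R) (f g : V -> W) (a : V) :
  (\near a, f a = g a) -> differentiable f a -> differentiable g a.
Proof.
move=> fg df.
have [dc fE] := (diff_locallyP a f).1 df.
have fga : f a = g a by exact: nbhs_singleton fg.
have gE : g \o shift a = cst (g a) + 'd f a +o_ (0 : V) id.
  apply/eqaddoP => eps eps0.
  have /eqaddoP/(_ _ eps0) := fE.
  have fgs : \forall x \near (0 : V), f (x + a) = g (x + a).
    move: fg; rewrite (near_shift 0 a).
    by apply: filterS => x /=; rewrite subr0.
  by apply: filterS2 fgs => x /= e; rewrite /= !fctE /= e fga.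
by apply/diff_locallyP; rewrite (diff_unique dc gE).
Qed.

Lemma open_near (T : topologicalType) (U : set T) (P : T -> Prop) (a : T) :
  open U -> U a -> (forall x, U x -> P x) -> \forall x \near a, P x.
Proof. by move=> oU Ua UP; apply: filterS UP _; exact: open_nbhs_nbhs. Qed.

Lemma differentiable_rV (V : normedModType R) (n : nat) (f : V -> 'rV[R]_n) a :
  (forall j, differentiable (fun x => f x 0 j) a) -> differentiable f a.
Proof.
move=> df; have -> : f = \sum_j (fun x => f x 0 j *: delta_mx 0 j).
  by apply/funext => x; rewrite fct_sumE -row_sum_delta.
by apply: differentiable_sum => j; apply: differentiableZl.
Qed.

Lemma derive_rV (V : normedModType R) (n : nat) (f : V -> 'rV[R]_n) a v j :
  derivable f a v -> ('D_v f a) 0 j = 'D_v (fun x => f x 0 j) a.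
Proof. by move=> df; rewrite derive_mx // mxE. Qed.

Lemma derive_comp (V W X : normedModType R) (f : W -> X) (g : V -> W) a v :
  differentiable g a -> differentiable f (g a) ->
  'D_v (f \o g) a = 'D_('D_v g a) f (g a).
Proof.
by move=> dg df; rewrite !deriveE //; [rewrite diff_comp|exact: differentiable_comp].
Qed.

Lemma derive_comp_rV (V X : normedModType R) n (f : 'rV[R]_n -> X)
    (g : V -> 'rV[R]_n) a v :
  differentiable g a -> differentiable f (g a) ->
  'D_v (f \o g) a =
  \sum_j 'D_v (fun x => g x 0 j) a *: 'D_(delta_mx 0 j) f (g a).
Proof.
move=> dg df; rewrite derive_comp // deriveE // [X in 'd _ _ X]row_sum_delta.
rewrite linear_sum; apply: eq_bigr => j _; rewrite linearZ -deriveE //.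
by rewrite derive_rV //; exact: diff_derivable.
Qed.

(** Openness of [U] is what makes the derivatives of [f] and [g] agree on [U]
    as well. *)
Lemma eq_Ck (n k : nat) (U : set 'rV[R]_n) (f g : 'rV[R]_n -> R) :
  open U -> (forall x, U x -> f x = g x) -> Ck k U f -> Ck k U g.
Proof.
move=> oU; elim: k f g => [|k IH] f g fg /=.
  move=> cf x Ux; have nfg := open_near oU Ux fg.
  rewrite /prop_for /continuous_at -(fg _ Ux).
  exact: cvg_trans (near_eq_cvg nfg) (cf x Ux).
move=> [df Df]; split=> [x Ux|i].
  exact: near_eq_differentiable (open_near oU Ux fg) (df x Ux).
apply: IH (Df i) => x Ux; apply: near_eq_derive; exact: open_near oU Ux fg.
Qed.

Lemma subset_Ck (n k : nat) (U V : set 'rV[R]_n) (f : 'rV[R]_n -> R) :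
  V `<=` U -> Ck k U f -> Ck k V f.
Proof.
move=> VU; elim: k f => [|k IH] f /=; first by move=> cf x /VU/cf.
by move=> [df Df]; split=> [x /VU/df//|i]; exact: IH.
Qed.

(** [Ck k.+1] asks for differentiability instead of continuity, hence the
    induction. *)
Lemma CkW (n k : nat) (U : set 'rV[R]_n) (f : 'rV[R]_n -> R) :
  Ck k.+1 U f -> Ck k U f.
Proof.
elim: k f => [|k IH] f /= [df Df]; last by split=> // i; apply: IH.
by move=> x Ux; apply: differentiable_continuous; exact: df.
Qed.

Lemma CkD (n k : nat) (U : set 'rV[R]_n) (f g : 'rV[R]_n -> R) :
  open U -> Ck k U f -> Ck k U g -> Ck k U (fun x => f x + g x).
Proof.
move=> oU; elim: k f g => [|k IH] f g /=.
  by move=> cf cg x Ux; exact: (@continuousD _ _ _ f g x (cf x Ux) (cg x Ux)).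
move=> [df Df] [dg Dg]; split=> [x Ux|i].
  by apply: differentiableD; [exact: df|exact: dg].
apply: eq_Ck (IH _ _ (Df i) (Dg i)) => // x Ux.
have dfx := @diff_derivable _ _ _ f x (delta_mx 0 i) (df x Ux).
have dgx := @diff_derivable _ _ _ g x (delta_mx 0 i) (dg x Ux).
by rewrite deriveD.
Qed.

Lemma CkM (n k : nat) (U : set 'rV[R]_n) (f g : 'rV[R]_n -> R) :
  open U -> Ck k U f -> Ck k U g -> Ck k U (fun x => f x * g x).
Proof.
move=> oU; elim: k f g => [|k IH] f g.
  by move=> cf cg x Ux; exact: (@continuousM _ _ f g x (cf x Ux) (cg x Ux)).
move=> Cf Cg; have [df Df] := Cf; have [dg Dg] := Cg; split=> [x Ux|i].
  by apply: differentiableM; [exact: df|exact: dg].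
apply: eq_Ck (CkD oU (IH _ _ (CkW Cf) (Dg i)) (IH _ _ (CkW Cg) (Df i))) => // x Ux.
have dfx := @diff_derivable _ _ _ f x (delta_mx 0 i) (df x Ux).
have dgx := @diff_derivable _ _ _ g x (delta_mx 0 i) (dg x Ux).
exact: esym (deriveM dfx dgx).
Qed.

Lemma Ck_cst (n k : nat) (U : set 'rV[R]_n) (c : R) : Ck k U (fun=> c).
Proof.
elim: k c => [|k IH] c /=; first by move=> x _; exact: cst_continuous.
split=> [x _|i]; first exact: differentiable_cst.
by have -> : 'D_(delta_mx 0 i) (fun=> c) = (fun=> 0) :> ('rV[R]_n -> R)
  by apply/funext => x; rewrite derive_cst.
Qed.

Lemma Ck_sum (n k : nat) (U : set 'rV[R]_n) (I : Type) (s : seq I) (f : I -> 'rV[R]_n -> R) :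
  open U -> (forall i, Ck k U (f i)) -> Ck k U (fun x => \sum_(i <- s) f i x).
Proof.
move=> oU Cf; elim: s => [|i s IH].
  by under eq_fun do rewrite big_nil; exact: Ck_cst.
by under eq_fun do rewrite big_cons; exact: CkD.
Qed.

(** By the chain rule the partial derivatives of [f \o g] are sums of products
    of functions of class [Ck k]. *)
Lemma Ck_comp (n l k : nat) (U : set 'rV[R]_n) (V : set 'rV[R]_l)
    (f : 'rV[R]_l -> R) (g : 'rV[R]_n -> 'rV[R]_l) :
  open U -> (forall x, U x -> V (g x)) -> Ck k V f ->
  (forall j, Ck k U (fun x => g x 0 j)) ->
  (forall x, U x -> {for x, continuous g}) ->
  Ck k U (fun x => f (g x)).
Proof.
move=> oU UV; elim: k f => [|k IH] f.
  move=> cf _ cg x Ux; apply: (@continuous_comp _ _ _ g f); first exact: cg.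
  exact/cf/UV.
move=> [df Df] Cg cg.
have dg x : U x -> differentiable g x.
  by move=> Ux; apply: differentiable_rV => j; case: (Cg j) => /(_ x Ux).
split=> [x Ux|i].
  by apply: differentiable_comp; [exact: dg|exact/df/UV].
apply: (@eq_Ck _ _ _ (fun x => \sum_j 'D_(delta_mx 0 i) (fun y => g y 0 j) x *
    'D_(delta_mx 0 j) f (g x))) => //.
  by move=> x Ux; rewrite (@derive_comp_rV _ _ _ f g) //; [exact: dg|exact/df/UV].
apply: Ck_sum => // j; apply: CkM => //; first by have [_] := Cg j; exact.
by apply: (IH _ (Df j)) => // j'; exact: CkW.
Qed.

Lemma smooth_diff (n : nat) (U : set 'rV[R]_n) f x :
  smooth_on U f -> U x -> differentiable f x.
Proof. by move=> /(_ 1%N)[df _] /df. Qed.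

Lemma smooth_rV_diff (n l : nat) (U : set 'rV[R]_n) (g : 'rV[R]_n -> 'rV[R]_l) x :
  (forall j, smooth_on U (fun x => g x 0 j)) -> U x -> differentiable g x.
Proof. by move=> sg Ux; apply: differentiable_rV => j; exact: smooth_diff (sg j) Ux. Qed.

Lemma eq_smooth_on (n : nat) (U : set 'rV[R]_n) (f g : 'rV[R]_n -> R) :
  open U -> (forall x, U x -> f x = g x) -> smooth_on U f -> smooth_on U g.
Proof. by move=> oU fg sf k; apply: eq_Ck (sf k). Qed.

Lemma subset_smooth_on (n : nat) (U V : set 'rV[R]_n) (f : 'rV[R]_n -> R) :
  V `<=` U -> smooth_on U f -> smooth_on V f.
Proof. by move=> VU sf k; apply: subset_Ck (sf k). Qed.

Lemma smooth_on_comp (n l : nat) (U : set 'rV[R]_n) (V : set 'rV[R]_l)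
    (f : 'rV[R]_l -> R) (g : 'rV[R]_n -> 'rV[R]_l) :
  open U -> (forall x, U x -> V (g x)) -> smooth_on V f ->
  (forall j, smooth_on U (fun x => g x 0 j)) ->
  smooth_on U (fun x => f (g x)).
Proof.
move=> oU UV sf sg k; apply: (Ck_comp oU UV (sf k)) => [j|x Ux]; first exact: (sg j k).
exact/differentiable_continuous/smooth_rV_diff/Ux.
Qed.

(** No condition in [Ck] relates different points of [U], which is why smoothness
    can be checked locally. *)
Lemma Ck_pointwise (n k : nat) (U : set 'rV[R]_n) (f : 'rV[R]_n -> R) :
  (forall x, U x -> Ck k [set x] f) -> Ck k U f.
Proof.
elim: k f => [|k IH] f /= Cf; first by move=> x Ux; exact: (Cf x Ux).
split=> [x Ux|i]; first by have [d _] := Cf x Ux; exact: d.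
by apply: IH => x Ux; have [_ d] := Cf x Ux; exact: d.
Qed.

Lemma smooth_on_local (n : nat) (U : set 'rV[R]_n) (f : 'rV[R]_n -> R) :
  (forall x, U x -> exists2 V, V x & smooth_on V f) -> smooth_on U f.
Proof.
move=> sf k; apply: Ck_pointwise => x Ux; have [V Vx sV] := sf x Ux.
by apply: subset_Ck (sV k) => _ ->.
Qed.

Lemma smooth_on_coord (n : nat) (U : set 'rV[R]_n) (i : 'I_n) :
  smooth_on U (fun v => v 0 i).
Proof.
case=> [|k] /=; first by move=> x _; exact/differentiable_continuous/differentiable_coord.
split=> [x _|j]; first exact: differentiable_coord.
suff -> : 'D_(delta_mx 0 j) (fun v : 'rV[R]_n => v 0 i) =
    (fun=> (delta_mx 0 j : 'rV[R]_n) 0 i) by exact: Ck_cst.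
apply/funext => v.
have id_v : derivable (id : 'rV[R]_n -> _) v (delta_mx 0 j) by exact: derivable_id.
by have := derive_rV i id_v; rewrite derive_id => <-.
Qed.

End calculus.

(** * Charts, smooth functions and tangent vectors *)

Section manifolds.
Variable R : realType.

(** The local part of the notion of manifold, to be used both for the base
    manifolds and for the total space of the dual bundle. *)
Record smooth_atlas (n : nat) (M : charted R n) : Prop := SmoothAtlas {
  atlas_chart_at : forall p : M, atlas (chart_at p) /\ cdom (chart_at p) p;
  atlas_chartK : forall c : chart R M n, atlas c ->
    forall p, cdom c p -> cinv c (cmap c p) = p;
  atlas_overlap : forall c d : chart R M n, atlas c -> atlas d ->
    open (cmap c @` (cdom c `&` cdom d)) /\
    forall i, smooth_on (cmap c @` (cdom c `&` cdom d))
                        (fun v => cmap d (cinv c v) 0 i) }.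

Lemma manifold_atlas (n : nat) (M : charted R n) :
  is_manifold M -> smooth_atlas M.
Proof. by case=> ? ? ? _ _; split. Qed.

Section one_manifold.
Variables (n : nat) (M : charted R n) (HM : smooth_atlas M).
Implicit Types (U V : set M) (f : M -> R) (c d : chart R M n).

(** Injectivity of the charts turns images of intersections into intersections
    of images; openness of intersections follows. *)
Lemma chart_imageI c U V : atlas c ->
  cmap c @` ((U `&` V) `&` cdom c) =
  cmap c @` (U `&` cdom c) `&` cmap c @` (V `&` cdom c).
Proof.
move=> ac; apply/seteqP; split=> v.
  by move=> [x [[Ux Vx] cx] <-]; split; exists x.
move=> [[x [Ux cx] <-] [y [Vy cy]]] => /(congr1 (cinv c)).
by rewrite !(atlas_chartK HM ac) // => e; exists x => //; split=> //; split=> //; rewrite -e.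
Qed.

Lemma mopenI U V : mopen U -> mopen V -> mopen (U `&` V).
Proof.
by move=> oU oV c ac; rewrite chart_imageI //; apply: openI; [exact: oU|exact: oV].
Qed.

Lemma mopen_cdom c : atlas c -> mopen (cdom c).
Proof. by move=> ac d ad; rewrite setIC; have [] := atlas_overlap HM ad ac. Qed.

Lemma mopenT : mopen [set: M].
Proof.
by move=> c ac; rewrite setTI -[cdom c]setIid; have [] := atlas_overlap HM ac ac.
Qed.

Lemma sub_smooth_fun U V f : V `<=` U -> smooth_fun U f -> smooth_fun V f.
Proof.
move=> VU sf c ac; apply: subset_smooth_on (sf c ac).
by apply: image_subset; exact: setSI.
Qed.

Lemma eq_smooth_fun U f g :
  mopen U -> (forall x, U x -> f x = g x) -> smooth_fun U f -> smooth_fun U g.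
Proof.
move=> oU fg sf c ac; apply: eq_smooth_on (sf c ac); first exact: oU.
by move=> _ [x [Ux cx] <-]; rewrite (atlas_chartK HM ac) // fg.
Qed.

Lemma smooth_fun_local U f :
  (forall x, U x -> exists2 V, V x & smooth_fun V f) -> smooth_fun U f.
Proof.
move=> sf c ac; apply: smooth_on_local => _ [x [Ux cx] <-].
by have [V Vx sV] := sf x Ux; exists (cmap c @` (V `&` cdom c)) => //; [exists x|exact: sV].
Qed.

Lemma smooth_funD U f g : mopen U -> smooth_fun U f -> smooth_fun U g ->
  smooth_fun U (fun x => f x + g x).
Proof.
by move=> oU sf sg c ac k; apply: CkD; [exact: oU|exact: sf|exact: sg].
Qed.

Lemma smooth_funM U f g : mopen U -> smooth_fun U f -> smooth_fun U g ->
  smooth_fun U (fun x => f x * g x).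
Proof.
by move=> oU sf sg c ac k; apply: CkM; [exact: oU|exact: sf|exact: sg].
Qed.

Lemma smooth_fun_cst U (a : R) : smooth_fun U (fun=> a).
Proof. by move=> c ac k; exact: Ck_cst. Qed.

Lemma smooth_fun_sum U (I : Type) (s : seq I) (f : I -> M -> R) :
  mopen U -> (forall i, smooth_fun U (f i)) ->
  smooth_fun U (fun x => \sum_(i <- s) f i x).
Proof.
by move=> oU sf c ac k; apply: Ck_sum => [|i]; [exact: oU|exact: sf].
Qed.

Lemma smooth_funN U f : mopen U -> smooth_fun U f -> smooth_fun U (fun x => - f x).
Proof.
move=> oU sf; have -> : (fun x => - f x) = (fun x => -1 * f x).
  by apply/funext => x; rewrite mulN1r.
exact: smooth_funM oU (smooth_fun_cst _ _) sf.
Qed.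

Lemma smooth_fun_coord c i : atlas c -> smooth_fun (cdom c) (fun p => cmap c p 0 i).
Proof. by move=> ac d ad; rewrite setIC; exact: (atlas_overlap HM ad ac).2. Qed.

Lemma smooth_fun_diff c U f p : atlas c -> cdom c p -> U p ->
  smooth_fun U f -> differentiable (fun v => f (cinv c v)) (cmap c p).
Proof. by move=> ac cp Up sf; apply: smooth_diff (sf c ac) _; exists p. Qed.

Lemma eq_near_chart c U f g p : atlas c -> mopen U -> cdom c p -> U p ->
  (forall x, U x -> f x = g x) ->
  \forall v \near cmap c p, f (cinv c v) = g (cinv c v).
Proof.
move=> ac oU cp Up fg; apply: (open_near (oU c ac)); first by exists p.
by move=> _ [x [Ux cx] <-]; rewrite (atlas_chartK HM ac) // fg.
Qed.

Lemma eq_tact U f g (p : M) (X : tangent p) : mopen U -> U p ->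
  (forall x, U x -> f x = g x) -> tact X f = tact X g.
Proof.
move=> oU Up fg; have [ac cp] := atlas_chart_at HM p.
by apply: near_eq_derive; exact: eq_near_chart cp Up fg.
Qed.

Lemma tactE U f (p : M) (X : tangent p) : U p -> smooth_fun U f ->
  tact X f = 'd (fun v => f (cinv (chart_at p) v)) (cmap (chart_at p) p) (X : 'rV[R]_n).
Proof.
move=> Up sf; have [ac cp] := atlas_chart_at HM p.
by rewrite /tact deriveE //; exact: smooth_fun_diff sf.
Qed.

Lemma tactD U f (p : M) (X Y : 'rV[R]_n) : U p -> smooth_fun U f ->
  tact (p := p) (X + Y : 'rV[R]_n) f = tact (p := p) X f + tact (p := p) Y f.
Proof. by move=> Up sf; rewrite !(tactE _ Up sf) linearD. Qed.

Lemma tactZ U f (p : M) (a : R) (X : 'rV[R]_n) : U p -> smooth_fun U f ->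
  tact (p := p) (a *: X : 'rV[R]_n) f = a * tact (p := p) X f.
Proof. by move=> Up sf; rewrite !(tactE _ Up sf) linearZ. Qed.

Lemma tact0 f (p : M) : tact (p := p) (0 : 'rV[R]_n) f = 0.
Proof. exact: derive0. Qed.

Lemma tact_sum U f (p : M) (I : Type) (s : seq I) (X : I -> 'rV[R]_n) :
  U p -> smooth_fun U f ->
  tact (p := p) (\sum_(i <- s) X i : 'rV[R]_n) f = \sum_(i <- s) tact (p := p) (X i) f.
Proof.
move=> Up sf; elim: s => [|i s IH]; first by rewrite !big_nil tact0.
by rewrite !big_cons (tactD _ _ Up sf) IH.
Qed.

Lemma tact_funD U f g (p : M) (X : tangent p) : U p ->
  smooth_fun U f -> smooth_fun U g ->
  tact X (fun x => f x + g x) = tact X f + tact X g.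
Proof.
move=> Up sf sg; have [ac cp] := atlas_chart_at HM p.
rewrite /tact deriveD //; apply: diff_derivable.
  exact: smooth_fun_diff sf.
exact: smooth_fun_diff sg.
Qed.

Lemma tact_cst (p : M) (X : tangent p) (a : R) : tact X (fun=> a) = 0.
Proof. exact: derive_cst. Qed.

Lemma tact_funM U f g (p : M) (X : tangent p) : U p ->
  smooth_fun U f -> smooth_fun U g ->
  tact X (fun x => f x * g x) = f p * tact X g + g p * tact X f.
Proof.
move=> Up sf sg; have [ac cp] := atlas_chart_at HM p.
rewrite /tact.
have df := smooth_fun_diff ac cp Up sf; have dg := smooth_fun_diff ac cp Up sg.
have := deriveM (@diff_derivable _ _ _ _ _ (X : 'rV[R]_n) df)
  (@diff_derivable _ _ _ _ _ (X : 'rV[R]_n) dg).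
by rewrite !(atlas_chartK HM ac cp).
Qed.

Lemma tact_fun_sum U (p : M) (X : tangent p) (I : Type) (s : seq I) (f : I -> M -> R) :
  mopen U -> U p -> (forall i, smooth_fun U (f i)) ->
  tact X (fun x => \sum_(i <- s) f i x) = \sum_(i <- s) tact X (f i).
Proof.
move=> oU Up sf; elim: s => [|i s IH].
  by under eq_fun do rewrite big_nil; rewrite big_nil tact_cst.
under eq_fun do rewrite big_cons.
by rewrite big_cons (tact_funD _ Up (sf i)) ?IH //; exact: smooth_fun_sum.
Qed.

Lemma tact_funN U f (p : M) (X : tangent p) : U p ->
  smooth_fun U f -> tact X (fun x => - f x) = - tact X f.
Proof.
move=> Up sf; have -> : (fun x => - f x) = (fun x => -1 * f x).
  by apply/funext => x; rewrite mulN1r.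
by rewrite (tact_funM _ Up (smooth_fun_cst U (-1)) sf) tact_cst mulr0 addr0 mulN1r.
Qed.

Lemma transition_diff c d p : atlas c -> atlas d -> cdom c p -> cdom d p ->
  differentiable (fun v => cmap d (cinv c v)) (cmap c p).
Proof.
move=> ac ad cp dp; apply: smooth_rV_diff (atlas_overlap HM ac ad).2 _.
by exists p.
Qed.

(** The chain rule: [coordv c i p] is the derivation [pderiv c i], although it
    is encoded by its components in the reference chart. *)
Lemma tact_coordv c i U f (p : M) : atlas c -> cdom c p -> mopen U -> U p ->
  smooth_fun U f -> tact (coordv c i p) f = pderiv c i f p.
Proof.
move=> ac cp oU Up sf; have [a0 c0p] := atlas_chart_at HM p.
have dt := transition_diff ac a0 cp c0p.
have df : differentiable (fun v => f (cinv (chart_at p) v))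
    (cmap (chart_at p) (cinv c (cmap c p))).
  by rewrite (atlas_chartK HM ac cp); exact: smooth_fun_diff a0 c0p Up sf.
have := @derive_comp _ _ _ _ _ (fun v => cmap (chart_at p) (cinv c v)) (cmap c p)
  (delta_mx 0 i) dt df.
rewrite /= (atlas_chartK HM ac cp) /tact /coordv => <-.
apply: near_eq_derive.
apply: (open_near (atlas_overlap HM ac a0).1); first by exists p.
by move=> _ [x [cx c0x] <-] /=; rewrite (atlas_chartK HM ac cx) (atlas_chartK HM a0 c0x).
Qed.

(** Read in the reference chart, the coordinate functions are linear near the
    image of [p]. *)
Lemma tact_coord (p : M) (X : tangent p) i :
  tact X (fun q => cmap (chart_at p) q 0 i) = (X : 'rV[R]_n) 0 i.
Proof.
have [a0 c0p] := atlas_chart_at HM p; rewrite /tact.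
have dX : derivable (id : 'rV[R]_n -> _) (cmap (chart_at p) p) (X : 'rV[R]_n).
  exact: derivable_id.
have := derive_rV i dX; rewrite derive_id => ->.
apply: near_eq_derive; apply: (open_near (mopen_cdom a0 a0)); first by exists p.
by move=> _ [x [cx _] <-]; rewrite (atlas_chartK HM a0 cx).
Qed.

Lemma tangent_eq (p : M) (X Y : 'rV[R]_n) :
  (forall i, tact (p := p) X (fun q => cmap (chart_at p) q 0 i) =
             tact (p := p) Y (fun q => cmap (chart_at p) q 0 i)) -> X = Y.
Proof. by move=> XY; apply/rowP => i; rewrite -!(@tact_coord p). Qed.

End one_manifold.

(** Around each point, insert a chart of [N] between [f] and [phi]. *)
Lemma smooth_fun_comp (m n : nat) (M : charted R m) (N : charted R n)
    (HM : smooth_atlas M) (HN : smooth_atlas N) (phi : M -> N) (V : set N) (f : N -> R) :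
  smooth_map phi -> mopen V -> smooth_fun V f ->
  smooth_fun (phi @^-1` V) (f \o phi).
Proof.
move=> [phio phis] oV sf; apply: smooth_fun_local => x Vx.
have [ad dx] := atlas_chart_at HN (phi x); set d := chart_at (phi x) in ad dx *.
exists (phi @^-1` (V `&` cdom d)) => // c ac.
have oW : open (cmap c @` (phi @^-1` (V `&` cdom d) `&` cdom c)).
  by apply: phio => //; apply: mopenI => //; exact: mopen_cdom.
apply: (@eq_smooth_on _ _ _ (fun v => f (cinv d (cmap d (phi (cinv c v)))))) => //.
  by move=> _ [y [[Vy dy] cy] <-]; rewrite (atlas_chartK HM ac cy) (atlas_chartK HN ad dy).
apply: (smooth_on_comp oW _ (sf d ad)).
  by move=> _ [y [[Vy dy] cy] <-]; rewrite (atlas_chartK HM ac cy); exists (phi y).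
move=> i; apply: subset_smooth_on (phis c d ac ad i).
by move=> _ [y [[Vy dy] cy] <-]; exists y.
Qed.

End manifolds.

(** * Frames of a vector bundle and of its dual *)

Lemma fr_nth (R : realType) (T : Type) (W : T -> vectType R) (k : nat)
  (s : lframe W k) a x : fr s a x = (s x)`_a.
Proof. by rewrite /fr (tnth_nth 0). Qed.

Section frames.
Variables (R : realType) (n : nat) (M : charted R n) (k : nat) (E : bundle M k).
Hypothesis (HM : smooth_atlas M) (HE : is_vector_bundle E).
Implicit Types (s t : lframe E k) (x : M) (u v : sect E) (U : set M).

Lemma comp_fr s x a b : frames s -> fdom s x -> comp s b (fr s a x) = (a == b)%:R.
Proof.
move=> fs sx; rewrite /comp fr_nth coord_free //.
exact: basis_free (frame_basis HE fs sx).
Qed.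

Lemma frame_sum s x (w : E x) : frames s -> fdom s x ->
  w = \sum_a comp s a w *: fr s a x.
Proof.
move=> fs sx; rewrite {1}(coord_basis (frame_basis HE fs sx) (memvf w)).
by apply: eq_bigr => a _; rewrite fr_nth.
Qed.

Lemma compD s x a (v w : E x) : comp s a (v + w) = comp s a v + comp s a w.
Proof. exact: linearD. Qed.

Lemma compZ s x a c (w : E x) : comp s a (c *: w) = c * comp s a w.
Proof. exact: linearZ. Qed.

Lemma comp_sum s x a (I : Type) (q : seq I) (w : I -> E x) :
  comp s a (\sum_(i <- q) w i) = \sum_(i <- q) comp s a (w i).
Proof. exact: linear_sum. Qed.

Lemma comp_inj s x (v w : E x) : frames s -> fdom s x ->
  (forall a, comp s a v = comp s a w) -> v = w.
Proof.
move=> fs sx e; rewrite [v](frame_sum _ fs sx) [w](frame_sum _ fs sx).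
by apply: eq_bigr => a _; rewrite e.
Qed.

Lemma smooth_sect_fr s a : frames s -> smooth_sect (fdom s) (fr s a).
Proof. by move=> fs t ft b; exact: frame_smooth. Qed.

Lemma sub_smooth_sect U V u : V `<=` U -> smooth_sect U u -> smooth_sect V u.
Proof. by move=> VU su s fs a; apply: sub_smooth_fun (su s fs a); exact: setSI. Qed.

Lemma smooth_sect_comp U u s a : frames s -> U `<=` fdom s -> smooth_sect U u ->
  smooth_fun U (fun x => comp s a (u x)).
Proof. by move=> fs Us su; apply: sub_smooth_fun (su s fs a) => x Ux; split=> //; exact: Us. Qed.

Lemma smooth_sectD U u v : mopen U -> smooth_sect U u -> smooth_sect U v ->
  smooth_sect U (fun x => u x + v x).
Proof.
move=> oU su sv s fs a; under eq_fun do rewrite compD.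
apply: smooth_funD (su s fs a) (sv s fs a).
by apply: (mopenI HM) => //; exact: (frame_open HE).
Qed.

Lemma smooth_sectZ U (f : M -> R) u : mopen U -> smooth_fun U f -> smooth_sect U u ->
  smooth_sect U (fun x => f x *: u x).
Proof.
move=> oU sf su s fs a; under eq_fun do rewrite compZ.
apply: smooth_funM (su s fs a); last exact: sub_smooth_fun (@subIsetl _ _ _) sf.
by apply: (mopenI HM) => //; exact: (frame_open HE).
Qed.

Lemma smooth_sect0 U : smooth_sect U (fun x => 0 : E x).
Proof.
move=> s fs a; under eq_fun do rewrite /comp linear0; exact: smooth_fun_cst.
Qed.

Lemma smooth_sect_local U u :
  (forall x, U x -> exists2 V, V x & smooth_sect V u) -> smooth_sect U u.
Proof.
move=> su s fs a; apply: smooth_fun_local => x [Ux sx].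
by have [V Vx sV] := su x Ux; exists (V `&` fdom s) => //; exact: sV.
Qed.

(** The components in the other frames are obtained by multiplication with the
    transition matrices. *)
Lemma smooth_sect_in_frame U u s : mopen U -> frames s -> U `<=` fdom s ->
  (forall a, smooth_fun U (fun x => comp s a (u x))) -> smooth_sect U u.
Proof.
move=> oU fs Us sc t ft b.
have oV : mopen (U `&` fdom t) by apply: (mopenI HM) => //; exact: (frame_open HE).
apply: (eq_smooth_fun HM (f := fun x => \sum_a comp s a (u x) * comp t b (fr s a x))) => //.
  move=> x [Ux tx]; rewrite [in RHS](frame_sum (u x) fs (Us _ Ux)) comp_sum.
  by apply: eq_bigr => a _; rewrite compZ.
apply: smooth_fun_sum => // a; apply: smooth_funM => //.
  exact: sub_smooth_fun (@subIsetl _ _ _) (sc a).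
by apply: sub_smooth_fun (frame_smooth HE fs ft a b) => x [/Us].
Qed.

Lemma dual_frE s a x (w : E x) : fr (dual_frame s) a x w = comp s a w.
Proof. by rewrite /fr /= tnth_mktuple lfunE. Qed.

(** Evaluation at the elements of [s] reads off the coordinates in the dual
    frame; this gives generation, and then freeness, of the dual frame. *)
Lemma dual_frame_sum s x (w : dual_fib E x) : frames s -> fdom s x ->
  w = \sum_a w (fr s a x) *: fr (dual_frame s) a x.
Proof.
move=> fs sx; apply/lfunP => z; rewrite {1}(frame_sum z fs sx) linear_sum sum_lfunE.
by apply: eq_bigr => a _; rewrite linearZ scale_lfunE dual_frE [LHS]mulrC.
Qed.

Lemma dual_frame_basis s x : frames s -> fdom s x ->
  basis_of fullv (dual_frame s x).
Proof.
move=> fs sx; apply/andP; split.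
  rewrite eqEsubv subvf; apply/subvP => w _; rewrite (dual_frame_sum w fs sx).
  by apply: rpred_sum => a _; apply: rpredZ; apply: memv_span; exact: mem_tnth.
apply/freeP => c c0 a; have := congr1 (fun w : dual_fib E x => w (fr s a x)) c0.
rewrite /= sum_lfunE zero_lfunE (bigD1 a) //= big1 ?addr0 => [|b ba].
  by rewrite scale_lfunE -(fr_nth (dual_frame s)) dual_frE comp_fr // eqxx => /= <-;
    rewrite [RHS]mulr1.
by rewrite scale_lfunE -(fr_nth (dual_frame s)) dual_frE comp_fr // eq_sym (negbTE ba) [LHS]mulr0.
Qed.

Lemma dual_comp s a x (w : dual_fib E x) : frames s -> fdom s x ->
  comp (dual_frame s) a w = w (fr s a x).
Proof.
move=> fs sx; rewrite {1}(dual_frame_sum w fs sx) /comp linear_sum (bigD1 a) //=.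
have f := basis_free (dual_frame_basis fs sx).
rewrite big1 ?addr0 => [|b ba].
  by rewrite linearZ /= (fr_nth (dual_frame s)) coord_free // eqxx mulr1.
by rewrite linearZ /= (fr_nth (dual_frame s)) coord_free // (negbTE ba) mulr0.
Qed.

(** The transition matrices of the dual frames are the transposed transition
    matrices of the frames in the opposite order. *)
Lemma dual_vector_bundle : is_vector_bundle (dual E).
Proof.
split=> [x|_ [s fs <-]|_ [s fs <-] x|_ _ [s fs <-] [t ft <-] a b].
- by have [? ?] := frame_atP HE x; split=> //; exists (frame_at E x).
- exact: (frame_open HE fs).
- exact: dual_frame_basis.
- have oU : mopen (fdom s `&` fdom t).
    by apply: (mopenI HM); exact: (frame_open HE).
  have := frame_smooth HE ft fs b a; rewrite setIC.
  apply: (eq_smooth_fun HM oU) => x [sx tx].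
  by rewrite dual_comp // dual_frE.
Qed.
End frames.

(** * The total space of the dual bundle *)

Section dual_total_space.
Variable R : realType.

Lemma smooth_on_lsubmx (m k : nat) (V : set 'rV[R]_m) (f : 'rV[R]_m -> R) :
  open V -> smooth_on V f ->
  smooth_on (lsubmx @^-1` V) (fun v : 'rV[R]_(m + k) => f (lsubmx v)).
Proof.
move=> oV sf; apply: (@smooth_on_comp _ _ _ _ V f lsubmx _ _ sf) => //.
  by apply: open_comp => // v _; exact: continuous_lsubmx.
by move=> j; under eq_fun do rewrite mxE; exact: smooth_on_coord.
Qed.

(** The two difference quotients coincide. *)
Lemma derive_lsubmx (m k : nat) (W : normedModType R) (f : 'rV[R]_m -> W)
    (v a : 'rV[R]_(m + k)) :
  'D_v (fun w : 'rV[R]_(m + k) => f (lsubmx w)) a = 'D_(lsubmx v) f (lsubmx a).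
Proof.
rewrite /derive; set F := (X in lim (X @ _)); set G := (X in _ = lim (X @ _)).
suff -> : F = G by [].
apply/funext => h; rewrite /F /G /=.
by have -> : lsubmx (h *: v + a) = h *: lsubmx v + lsubmx a by rewrite linearP.
Qed.

Variables (m : nat) (M : charted R m) (HM : smooth_atlas M).
Variables (k : nat) (E : bundle M k) (HE : is_vector_bundle E).
Implicit Types (c d : chart R M m) (s t : lframe E k) (x : M) (e : dual_total E).
Implicit Types (U V : set M).

Definition dual_point s x (p : 'rV[R]_k) : dual_total E :=
  Tagged (dual_fib E) (\sum_a p 0 a *: fr (dual_frame s) a x).

Lemma dual_pointE s e : frames s -> fdom s (dproj e) ->
  dual_point s (dproj e) (\row_a pcoord s a e) = e.
Proof.
case: e => x w fs sx; rewrite /dual_point /=; congr existT.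
rewrite [RHS](dual_frame_sum HE w fs sx).
by apply: eq_bigr => a _; rewrite mxE.
Qed.

Lemma pcoord_point s t a x p :
  pcoord t a (dual_point s x p) = \sum_b p 0 b * comp s b (fr t a x).
Proof.
rewrite /pcoord /= sum_lfunE; apply: eq_bigr => b _.
by rewrite scale_lfunE dual_frE.
Qed.

Lemma dchart_map c s e :
  cmap (dchart c s) e = row_mx (cmap c (dproj e)) (\row_a pcoord s a e).
Proof. by []. Qed.

Lemma dchart_inv c s v :
  cinv (dchart c s) v = dual_point s (cinv c (lsubmx v)) (rsubmx v).
Proof. by []. Qed.

Lemma dchartK c s : atlas c -> frames s -> forall e, cdom (dchart c s) e ->
  cinv (dchart c s) (cmap (dchart c s) e) = e.
Proof.
move=> ac fs e [ce se].
rewrite dchart_map dchart_inv row_mxKl row_mxKr (atlas_chartK HM ac) //.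
exact: dual_pointE.
Qed.

(** Above each point of the base all values of the fibre coordinates occur. *)
Lemma dchart_image c s U : atlas c -> frames s ->
  cmap (dchart c s) @` (@dproj _ _ M k E @^-1` U `&` cdom (dchart c s)) =
  lsubmx @^-1` (cmap c @` ((U `&` fdom s) `&` cdom c)).
Proof.
move=> ac fs; apply/seteqP; split=> v.
  by move=> [e [Ue [ce se]] <-]; rewrite dchart_map /= row_mxKl; exists (dproj e).
move=> [x [[Ux sx] cx] xv].
have vx : cinv c (lsubmx v) = x by rewrite -xv (atlas_chartK HM ac).
exists (cinv (dchart c s) v).
  by rewrite dchart_inv vx.
rewrite dchart_map dchart_inv vx /= xv -[RHS]hsubmxK; congr row_mx.
apply/rowP => a; rewrite mxE pcoord_point (bigD1 a) //= big1 ?addr0 => [|b ba].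
  by rewrite (comp_fr HE) // eqxx mulr1.
by rewrite (comp_fr HE) // eq_sym (negbTE ba) mulr0.
Qed.

Lemma open_dchart_image c s U : atlas c -> frames s -> mopen U ->
  open (cmap (dchart c s) @` (@dproj _ _ M k E @^-1` U `&` cdom (dchart c s))).
Proof.
move=> ac fs oU; rewrite dchart_image //; apply: open_comp.
  by move=> v _; exact: continuous_lsubmx.
by apply: (mopenI HM) => //; exact: (frame_open HE).
Qed.

Lemma mopen_dproj U : mopen U -> mopen (@dproj _ _ M k E @^-1` U).
Proof. by move=> oU _ [c [s [ac fs ->]]]; exact: open_dchart_image. Qed.

Lemma dchart_base_smooth c s U (f : M -> R) : atlas c -> frames s -> mopen U ->
  smooth_fun U f ->
  smooth_on (cmap (dchart c s) @` (@dproj _ _ M k E @^-1` U `&` cdom (dchart c s)))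
    (fun v => f (cinv c (lsubmx v))).
Proof.
move=> ac fs oU sf; rewrite dchart_image //.
apply: (@smooth_on_lsubmx m k (cmap c @` ((U `&` fdom s) `&` cdom c))
  (fun v => f (cinv c v))).
  by apply: (mopenI HM) => //; exact: (frame_open HE).
by apply: sub_smooth_fun sf c ac; exact: subIsetl.
Qed.

Lemma dchart_pcoord_smooth c s t a : atlas c -> frames s -> frames t ->
  smooth_on (cmap (dchart c s) @` (@dproj _ _ M k E @^-1` fdom t `&` cdom (dchart c s)))
    (fun v => pcoord t a (cinv (dchart c s) v)).
Proof.
move=> ac fs ft; under eq_fun do rewrite dchart_inv pcoord_point.
have oS : mopen (fdom t `&` fdom s) by apply: (mopenI HM); exact: (frame_open HE).
have -> : @dproj _ _ M k E @^-1` fdom t `&` cdom (dchart c s) =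
          @dproj _ _ M k E @^-1` (fdom t `&` fdom s) `&` cdom (dchart c s).
  by apply/seteqP; split=> e /= [] => [te [ce se]|[te _] []].
have oI := open_dchart_image ac fs oS.
move=> l; apply: Ck_sum => // b; apply: CkM => //.
  by under eq_fun do rewrite mxE; exact: smooth_on_coord.
exact: dchart_base_smooth (frame_smooth HE ft fs a b) l.
Qed.

(** A change of charts is a change of coordinates on [M] together with a map
    that is linear in the fibre coordinates, with smooth coefficients. *)
Lemma dual_total_atlas : smooth_atlas (dual_total E).
Proof.
split=> [e|_ [c [s [ac fs ->]]]|_ _ [c [s [ac fs ->]]] [d [t [ad ft ->]]]].
- have [ac cx] := atlas_chart_at HM (dproj e).
  have [fs sx] := frame_atP HE (dproj e).
  by split=> //; exists (chart_at (dproj e)), (frame_at E (dproj e)).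
- exact: dchartK.
- have -> : cdom (dchart c s) `&` cdom (dchart d t) =
      @dproj _ _ M k E @^-1` (cdom d `&` fdom t) `&` cdom (dchart c s).
    by rewrite setIC.
  have oS : mopen (cdom d `&` fdom t).
    by apply: (mopenI HM); [exact: mopen_cdom|exact: (frame_open HE)].
  split=> [|i]; first exact: open_dchart_image.
  case: (splitP i) => [j|b] ij.
    have -> : i = lshift k j by exact: val_inj.
    under eq_fun do rewrite dchart_map row_mxEl.
    apply: (dchart_base_smooth (f := fun p => cmap d p 0 j)) => //.
    apply: sub_smooth_fun (smooth_fun_coord HM j ad); exact: subIsetl.
  have -> : i = rshift m b by exact: val_inj.
  under eq_fun do rewrite dchart_map row_mxEr mxE.
  apply: subset_smooth_on (dchart_pcoord_smooth b ac fs ft).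
  by apply: image_subset => e /= [[_ te] ce].
Qed.

Lemma smooth_fun_dproj U (f : M -> R) : mopen U -> smooth_fun U f ->
  smooth_fun (@dproj _ _ M k E @^-1` U) (fun e => f (dproj e)).
Proof. by move=> oU sf _ [c [s [ac fs ->]]]; exact: dchart_base_smooth. Qed.

Lemma smooth_fun_pcoord s a : frames s ->
  smooth_fun (@dproj _ _ M k E @^-1` fdom s) (pcoord s a).
Proof. by move=> fs _ [c [t [ac ft ->]]]; exact: dchart_pcoord_smooth. Qed.

Lemma pderiv_lshift_base c s i (f : M -> R) e :
  pderiv (M := dual_total E) (dchart c s) (lshift k i) (fun e => f (dproj e)) e =
  pderiv c i f (dproj e).
Proof.
rewrite /pderiv (derive_lsubmx (fun v => f (cinv c v))) dchart_map row_mxKl.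
congr ('D_ _ _ _); apply/rowP => j; rewrite !mxE /=.
by rewrite (inj_eq (@lshift_inj _ _)).
Qed.

Lemma pderiv_rshift_base c s a (f : M -> R) e :
  pderiv (M := dual_total E) (dchart c s) (rshift m a) (fun e => f (dproj e)) e = 0.
Proof.
rewrite /pderiv (derive_lsubmx (fun v => f (cinv c v))).
have -> : lsubmx (delta_mx 0 (rshift m a)) = 0 :> 'rV[R]_m.
  by apply/rowP => j; rewrite !mxE eq_lrshift andbF.
exact: derive0.
Qed.

Lemma pderiv_pcoord c s j a e : atlas c -> frames s -> cdom (dchart c s) e ->
  pderiv (M := dual_total E) (dchart c s) j (pcoord s a) e = (j == rshift m a)%:R.
Proof.
move=> ac fs ce; rewrite /pderiv.
have ad : @atlas R (m + k) (dual_total E) (dchart c s) by exists c, s.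
set D := delta_mx 0 j.
have dD : derivable (id : 'rV[R]_(m + k) -> _) (cmap (dchart c s) e) D.
  exact: derivable_id.
have := derive_rV (rshift m a) dD; rewrite derive_id mxE eqxx eq_sym andTb => ->.
apply: near_eq_derive.
apply: (open_near (mopen_cdom dual_total_atlas ad ad)); first by exists e.
move=> _ [q [cq _] <-]; rewrite (dchartK ac fs cq).
by rewrite dchart_map row_mxEr mxE.
Qed.

End dual_total_space.

(** * Tangent vectors of the total space *)

Section dual_total_tangent.
Variable R : realType.
Variables (m : nat) (M : charted R m) (HM : smooth_atlas M).
Variables (k : nat) (E : bundle M k) (HE : is_vector_bundle E).
Implicit Types (c d : chart R M m) (s t : lframe E k) (x : M) (e : dual_total E).
Implicit Types (U V : set M).

Let HT := dual_total_atlas HM HE.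

Lemma atlas_dchart c s : atlas c -> frames s ->
  @atlas R (m + k) (dual_total E) (dchart c s).
Proof. by move=> ac fs; exists c, s. Qed.

Lemma tact_lshift_base c s i U (f : M -> R) e : atlas c -> frames s ->
  cdom (dchart c s) e -> mopen U -> U (dproj e) -> smooth_fun U f ->
  tact (coordv (M := dual_total E) (dchart c s) (lshift k i) e) (fun q => f (dproj q)) =
  pderiv c i f (dproj e).
Proof.
move=> ac fs ce oU Ux sf.
rewrite (tact_coordv HT _ (atlas_dchart ac fs) ce (mopen_dproj HM HE oU) Ux
  (smooth_fun_dproj HM HE oU sf)).
exact: pderiv_lshift_base.
Qed.

Lemma tact_rshift_base c s a U (f : M -> R) e : atlas c -> frames s ->
  cdom (dchart c s) e -> mopen U -> U (dproj e) -> smooth_fun U f ->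
  tact (coordv (M := dual_total E) (dchart c s) (rshift m a) e) (fun q => f (dproj q)) = 0.
Proof.
move=> ac fs ce oU Ux sf.
rewrite (tact_coordv HT _ (atlas_dchart ac fs) ce (mopen_dproj HM HE oU) Ux
  (smooth_fun_dproj HM HE oU sf)).
exact: pderiv_rshift_base.
Qed.

Lemma tact_coordv_pcoord c s j a e : atlas c -> frames s ->
  cdom (dchart c s) e ->
  tact (coordv (M := dual_total E) (dchart c s) j e) (pcoord s a) = (j == rshift m a)%:R.
Proof.
move=> ac fs ce; have [cx sx] := ce.
rewrite (tact_coordv HT _ (atlas_dchart ac fs) ce
  (mopen_dproj HM HE (frame_open HE fs)) sx (smooth_fun_pcoord HM HE a fs)).
exact: pderiv_pcoord.
Qed.

Lemma pcoord_change s t a e : frames s -> fdom s (dproj e) ->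
  pcoord t a e = \sum_b pcoord s b e * comp s b (fr t a (dproj e)).
Proof.
move=> fs sx; rewrite -{1}(dual_pointE HE fs sx) pcoord_point.
by apply: eq_bigr => b _; rewrite mxE.
Qed.

Lemma tact_pcoord_change s t a e (X : tangent e) : frames s -> frames t ->
  fdom s (dproj e) -> fdom t (dproj e) ->
  tact X (pcoord t a) =
  \sum_b (pcoord s b e * tact X (fun q => comp s b (fr t a (dproj q))) +
          comp s b (fr t a (dproj e)) * tact X (pcoord s b)).
Proof.
move=> fs ft sx tx.
have oU : mopen (fdom t `&` fdom s) by apply: (mopenI HM); exact: (frame_open HE).
have oW := mopen_dproj HM HE oU.
have We : (@dproj _ _ M k E @^-1` (fdom t `&` fdom s)) e by [].
rewrite (eq_tact HT X oW We
  (g := fun q => \sum_b pcoord s b q * comp s b (fr t a (dproj q)))); last first.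
  by move=> q [_ sq]; exact: pcoord_change.
have s1 b : smooth_fun (@dproj _ _ M k E @^-1` (fdom t `&` fdom s)) (pcoord s b).
  by apply: sub_smooth_fun (smooth_fun_pcoord HM HE b fs) => q [].
have s2 b : smooth_fun (@dproj _ _ M k E @^-1` (fdom t `&` fdom s))
    (fun q => comp s b (fr t a (dproj q))).
  exact: (smooth_fun_dproj HM HE oU (frame_smooth HE ft fs a b)).
rewrite (tact_fun_sum HT X _ oW We); last by move=> b; exact: smooth_funM.
by apply: eq_bigr => b _; rewrite (tact_funM HT X We (s1 b) (s2 b)).
Qed.

(** The coordinates of the reference chart are of these two kinds, except that
    its fibre coordinates may belong to another frame; [tact_pcoord_change]
    reduces them to those of [s]. *)
Lemma dual_tangent_eq s e (X Y : 'rV[R]_(m + k)) : frames s -> fdom s (dproj e) ->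
  (forall U (f : M -> R), mopen U -> U (dproj e) -> smooth_fun U f ->
     tact (p := e) X (fun q => f (dproj q)) = tact (p := e) Y (fun q => f (dproj q))) ->
  (forall a, tact (p := e) X (pcoord s a) = tact (p := e) Y (pcoord s a)) -> X = Y.
Proof.
move=> fs sx XYb XYp; apply: (tangent_eq HT (p := e)) => i.
have [ac cx] := atlas_chart_at HM (dproj e).
have [ft tx] := frame_atP HE (dproj e).
have -> : chart_at e = dchart (chart_at (dproj e)) (frame_at E (dproj e)) by [].
case: (splitP i) => [j|b] ij.
  have -> : i = lshift k j by exact: val_inj.
  under eq_fun do rewrite dchart_map row_mxEl.
  exact: (XYb _ (fun p => cmap _ p 0 j) (mopen_cdom HM ac) cx (smooth_fun_coord HM j ac)).
have -> : i = rshift m b by exact: val_inj.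
under eq_fun do rewrite dchart_map row_mxEr mxE.
rewrite !(tact_pcoord_change b _ fs ft sx tx).
have oU : mopen (fdom (frame_at E (dproj e)) `&` fdom s).
  by apply: (mopenI HM); exact: (frame_open HE).
apply: eq_bigr => a _; rewrite XYp.
by rewrite (XYb _ (fun q => comp s a (fr (frame_at E (dproj e)) b q)) oU (conj tx sx)
  (frame_smooth HE ft fs b a)).
Qed.

End dual_total_tangent.

(** * Brackets expanded in a local frame *)

Lemma fsect_eq (R : realType) (T : Type) (W : T -> lmodType R) (z w : fsect W) :
  (forall x, z x = w x) -> z = w.
Proof. exact: functional_extensionality_dep. Qed.

Section bracket_expansion.
Variables (R : realType) (n : nat) (X : charted R n) (W : X -> lmodType R).
Variables (sec : set X -> fsect W -> Prop) (act : fsect W -> (X -> R) -> X -> R).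
Variables (b : fsect W -> fsect W -> fsect W).
Hypothesis Hb : is_algebroid_bracket sec act b.
Variable V : set X.
Hypothesis oV : mopen V.
Variable S : fsect W -> Prop.
(* [S] is a class of sections over [V] that is stable under the operations
   needed to form frame expansions.  For sections of a vector bundle it consists
   of all smooth sections over [V]; for the generalized tangent bundle, of the
   combinations of one fixed frame. *)
Hypothesis S_sec : forall z, S z -> sec V z.
Hypothesis S0 : S (fun _ => 0).
Hypothesis SD : forall z w, S z -> S w -> S (fun x => z x + w x).
Hypothesis SZ : forall f z, smooth_fun V f -> S z -> S (fun x => f x *: z x).

Lemma br_addr z w w' x : sec V z -> S w -> S w' -> V x ->
  b z (fun y => w y + w' y) x = b z w x + b z w' x.
Proof.
move=> sz Sw Sw' Vx; have sw := S_sec Sw; have sw' := S_sec Sw'.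
rewrite (br_anti Hb oV sz (S_sec (SD Sw Sw')) Vx) (br_add Hb oV sw sw' sz Vx) opprD.
by rewrite -(br_anti Hb oV sz sw Vx) -(br_anti Hb oV sz sw' Vx).
Qed.

Lemma br_0r z x : sec V z -> V x -> b z (fun=> 0) x = 0.
Proof.
move=> sz Vx; have := br_addr sz S0 S0 Vx.
rewrite (_ : (fun y => 0 + 0) = fun=> 0); last by apply: fsect_eq => y; rewrite addr0.
by move/(congr1 (fun w => w - b z (fun=> 0) x)); rewrite addrK subrr.
Qed.

Lemma S_sum (I : Type) (q : seq I) (y : I -> X -> R) (f : I -> fsect W) :
  (forall i, smooth_fun V (y i)) -> (forall i, S (f i)) ->
  S (fun x => \sum_(i <- q) y i x *: f i x).
Proof.
move=> sy Sf; elim: q => [|i q IH].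
  by rewrite (_ : (fun x => _) = fun=> 0) //; apply: fsect_eq => x; rewrite big_nil.
rewrite (_ : (fun x => _) = fun x => y i x *: f i x + \sum_(j <- q) y j x *: f j x).
  by apply: SD => //; exact: SZ.
by apply: fsect_eq => x; rewrite big_cons.
Qed.

Lemma br_sumr (I : Type) (q : seq I) (y : I -> X -> R) (f : I -> fsect W) z x :
  sec V z -> (forall i, smooth_fun V (y i)) -> (forall i, S (f i)) -> V x ->
  b z (fun x => \sum_(i <- q) y i x *: f i x) x =
  \sum_(i <- q) (y i x *: b z (f i) x + act z (y i) x *: f i x).
Proof.
move=> sz sy Sf Vx; elim: q => [|i q IH].
  rewrite big_nil -[RHS](br_0r sz Vx) (_ : (fun x => _) = fun=> 0) //.
  by apply: fsect_eq => y'; rewrite big_nil.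
rewrite (_ : (fun x => _) = fun x => y i x *: f i x + \sum_(j <- q) y j x *: f j x).
  2: by apply: fsect_eq => y'; rewrite big_cons.
rewrite big_cons br_addr ?IH //; [|exact: SZ|exact: S_sum].
by rewrite (br_leibniz Hb oV (sy i) sz (S_sec (Sf i)) Vx).
Qed.

(** The Leibniz rule in each argument. *)
Lemma br_frame (I : finType) (f : I -> fsect W) (xi y : I -> X -> R) x :
  (forall i, S (f i)) -> (forall i, smooth_fun V (xi i)) ->
  (forall i, smooth_fun V (y i)) -> V x ->
  (forall phi, smooth_fun V phi ->
     act (fun x => \sum_i y i x *: f i x) phi x = \sum_i y i x * act (f i) phi x) ->
  b (fun x => \sum_i xi i x *: f i x) (fun x => \sum_i y i x *: f i x) x =
  \sum_i \sum_j (xi i x * y j x) *: b (f i) (f j) x +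
  \sum_i (act (fun x => \sum_i xi i x *: f i x) (y i) x -
          act (fun x => \sum_i y i x *: f i x) (xi i) x) *: f i x.
Proof.
move=> Sf sx sy Vx act_lin.
set z := (fun x => \sum_i xi i x *: f i x); set w := (fun x => \sum_i y i x *: f i x).
have sz : sec V z by apply: S_sec; exact: S_sum.
rewrite br_sumr //.
have bf j : b z (f j) x = \sum_i (xi i x *: b (f i) (f j) x - act (f j) (xi i) x *: f i x).
  rewrite (br_anti Hb oV sz (S_sec (Sf j)) Vx) br_sumr //; last exact: S_sec.
  rewrite -sumrN; apply: eq_bigr => i _.
  by rewrite (br_anti Hb oV (S_sec (Sf j)) (S_sec (Sf i)) Vx) scalerN opprD opprK.
under eq_bigr do rewrite bf.
rewrite big_split /=.
under [X in _ = _ + X]eq_bigr do rewrite scalerBl.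
rewrite sumrB; under [X in _ = _ + (_ - X)]eq_bigr do rewrite act_lin // scaler_suml.
rewrite [X in _ = _ + (_ - X)]exchange_big [X in _ = X + _]exchange_big /=.
rewrite [in RHS]addrCA [RHS]addrC; congr (_ + _).
rewrite -sumrB; apply: eq_bigr => j _.
rewrite scaler_sumr -sumrB; apply: eq_bigr => i _.
by rewrite scalerBr !scalerA mulrC.
Qed.

End bracket_expansion.

(** * The Lie algebroid structure carried over to the dual bundle *)

Section transport.
Variables (R : realType) (m n r p : nat) (M : charted R m) (N : charted R n).
Variables (HM : smooth_atlas M) (HN : smooth_atlas N) (h : diffeo M N).
Variables (E : bundle M r) (F : bundle N p).
Variables (HE : is_vector_bundle E) (HF : is_vector_bundle F).
Variables (g : bmorphism h (dual E) F) (Hg : locally_invertible g).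
Implicit Types (u v : sect (dual E)) (z w : sect F) (s : lframe E r) (t : lframe F p).

Lemma dfun_onto (y : N) : exists x, y = h x.
Proof. by exists (dinv h y); rewrite dinvK. Qed.

(** Along the image of [h] the transport between fibres in [gsec] is along a
    reflexivity proof. *)
Lemma gsecE u x : gsec g u (h x) = g x (u x).
Proof.
rewrite /gsec; move: (dinvK h (h x)); rewrite (dfunK h x) => e.
by rewrite (Prop_irrelevance e erefl).
Qed.

Let HdE : is_vector_bundle (dual E) := dual_vector_bundle HM HE.

Let gcomp s t al a x : R := comp t al (g x (fr (dual_frame s) a x)).

Lemma comp_g s t al x (w : dual E x) : frames s -> fdom s x ->
  comp t al (g x w) = \sum_a gcomp s t al a x * comp (dual_frame s) a w.
Proof.
move=> fs sx; have fd : @frames _ _ _ _ (dual E) (dual_frame s) by exists s.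
rewrite {1}(frame_sum HdE w fd sx) linear_sum comp_sum.
by apply: eq_bigr => a _; rewrite linearZ compZ mulrC.
Qed.

Lemma g_lker0 x : lker (g x) == 0%VS.
Proof.
have [fs sx] := frame_atP HE x; have [ft tx] := frame_atP HF (h x).
have fd : @frames _ _ _ _ (dual E) (dual_frame (frame_at E x)) by exists (frame_at E x).
have [gt [_ /(_ x sx tx) [gtg _]]] := Hg fs ft.
apply/lker0P => w w' ww'; apply: (comp_inj HdE fd sx) => b.
have co (w0 : dual E x) : comp (dual_frame (frame_at E x)) b w0 =
    \sum_al gt b al x * comp (frame_at F (h x)) al (g x w0).
  under eq_bigr do rewrite (comp_g _ _ _ fs sx) mulr_sumr.
  rewrite exchange_big /=.
  under eq_bigr do (under eq_bigr do rewrite mulrA; rewrite -mulr_suml gtg).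
  rewrite (bigD1 b) //= eqxx mul1r big1 ?addr0 // => a ab.
  by rewrite eq_sym (negbTE ab) mul0r.
by rewrite !co ww'.
Qed.

Lemma gK x : cancel (g x) ((g x)^-1)%VF.
Proof. exact: lker0_lfunK (g_lker0 x). Qed.

(** The local inverse matrix [gt] provides preimages. *)
Lemma g_onto s t (gt : 'I_r -> 'I_p -> M -> R) x (z : F (h x)) :
  frames s -> frames t -> fdom s x -> fdom t (h x) ->
  (forall al be, \sum_a gcomp s t al a x * gt a be x = (al == be)%:R) ->
  g x (\sum_a (\sum_al gt a al x * comp t al z) *: fr (dual_frame s) a x) = z.
Proof.
move=> fs ft sx tx ggt; apply: (comp_inj HF ft tx) => al.
rewrite linear_sum comp_sum.
under eq_bigr do rewrite linearZ compZ mulr_suml.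
rewrite exchange_big /= (bigD1 al) //= [X in _ + X]big1 => [|be ba].
  have e : \sum_a gcomp s t al a x * gt a al x = 1 by rewrite ggt eqxx.
  rewrite addr0 -[RHS]mul1r -e.
  by rewrite mulr_suml; apply: eq_bigr => a _; rewrite mulrAC [_ * gt _ _ _]mulrC.
have e : \sum_a gcomp s t al a x * gt a be x = 0 by rewrite ggt eq_sym (negbTE ba).
rewrite -[RHS](mul0r (comp t be z)) -[X in _ = X * _]e mulr_suml; apply: eq_bigr => a _.
by rewrite mulrAC [_ * gt _ _ _]mulrC.
Qed.

Lemma gVK x : cancel ((g x)^-1)%VF (g x).
Proof.
move=> z; have [fs sx] := frame_atP HE x; have [ft tx] := frame_atP HF (h x).
have [gt [_ /(_ x sx tx) [_ ggt]]] := Hg fs ft.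
by rewrite -(g_onto z fs ft sx tx ggt) gK.
Qed.

Lemma gsec_invK z : gsec g (gsec_inv g z) = z.
Proof.
by apply: fsect_eq => y; have [x ->] := dfun_onto y; rewrite gsecE gVK.
Qed.

Lemma gsecD u v : gsec g (fun x => u x + v x) = (fun y => gsec g u y + gsec g v y).
Proof.
by apply: fsect_eq => y; have [x ->] := dfun_onto y; rewrite !gsecE linearD.
Qed.

Lemma gsecZ (f : M -> R) u :
  gsec g (fun x => f x *: u x) = (fun y => f (dinv h y) *: gsec g u y).
Proof.
by apply: fsect_eq => y; have [x ->] := dfun_onto y; rewrite !gsecE linearZ dfunK.
Qed.

Lemma mopen_dinv V : mopen V -> mopen (dinv h @^-1` V).
Proof. exact: (dinv_smooth h).1. Qed.

Lemma mopen_dfun V : mopen V -> mopen (h @^-1` V).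
Proof. exact: (dfun_smooth h).1. Qed.

Lemma smooth_comp_g V u s t al : mopen V -> smooth_sect V u -> frames s -> frames t ->
  V `<=` fdom s -> V `<=` h @^-1` fdom t -> smooth_fun V (fun x => comp t al (g x (u x))).
Proof.
move=> oV su fs ft Vs Vt.
have fd : @frames _ _ _ _ (dual E) (dual_frame s) by exists s.
apply: (eq_smooth_fun HM (f := fun x => \sum_a gcomp s t al a x *
    comp (dual_frame s) a (u x))) => // [x Vx|].
  by rewrite (comp_g _ _ _ fs) //; exact: Vs.
apply: smooth_fun_sum => // a; apply: smooth_funM => //.
  by apply: sub_smooth_fun (bmor_smooth g fd ft a al) => x Vx; split; [exact: Vs|exact: Vt].
exact: (smooth_sect_comp (E := dual E) a fd Vs su).
Qed.

Lemma smooth_gsec V u : mopen V -> smooth_sect V u ->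
  smooth_sect (dinv h @^-1` V) (gsec g u).
Proof.
move=> oV su t ft al; apply: smooth_fun_local => y [Vy ty].
have [fs sx] := frame_atP HE (dinv h y); set s := frame_at E _ in fs sx.
pose U := (V `&` fdom s) `&` h @^-1` fdom t.
have oU : mopen U.
  apply: (mopenI HM); last by apply: mopen_dfun; exact: (frame_open HF).
  by apply: (mopenI HM) => //; exact: (frame_open HE).
exists (dinv h @^-1` U); first by split; [split|rewrite /= dinvK].
have sU : smooth_fun U (fun x => comp t al (g x (u x))).
  apply: (smooth_comp_g (s := s)) => // [|x [[]]|x []] //.
  by apply: sub_smooth_sect su => x [[]].
apply: (eq_smooth_fun HN) (smooth_fun_comp HN HM (dinv_smooth h) oU sU).
  exact: mopen_dinv.
by move=> y' _; have [x ->] := dfun_onto y'; rewrite gsecE /= dfunK.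
Qed.

(** In dual frames the components of [gsec_inv g z] are obtained from those of
    [z] by the inverse matrix, which is smooth by local invertibility. *)
Lemma smooth_gsec_inv V z : mopen V -> smooth_sect V z ->
  smooth_sect (h @^-1` V) (gsec_inv g z).
Proof.
move=> oV sz; apply: smooth_sect_local => x Vx.
have [fs sx] := frame_atP HE x; set s := frame_at E x in fs sx.
have [ft tx] := frame_atP HF (h x); set t := frame_at F _ in ft tx.
have fd : @frames _ _ _ _ (dual E) (dual_frame s) by exists s.
have [gt [sgt ggt]] := Hg fs ft.
pose U := (h @^-1` (V `&` fdom t)) `&` fdom s.
have oVt : mopen (V `&` fdom t) by apply: (mopenI HN) => //; exact: (frame_open HF).
have oU : mopen U.
  by apply: (mopenI HM); [exact: mopen_dfun|exact: (frame_open HE)].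
exists U => //; apply: (smooth_sect_in_frame HM HdE oU fd) => [x' []//|a].
apply: (eq_smooth_fun HM (f := fun x => \sum_al gt a al x * comp t al (z (h x)))) => //.
  move=> x' [[Vx' tx'] sx']; have [_ ggt'] := ggt _ sx' tx'.
  rewrite /gsec_inv -[in RHS](g_onto (z (h x')) fs ft sx' tx' ggt') gK.
  rewrite (comp_sum (E := dual E)) [RHS](bigD1 a) // [X in _ = _ + X]big1 => [|b ba].
    by rewrite addr0 (compZ (E := dual E)) (comp_fr HdE a a fd) // eqxx mulr1.
  by rewrite (compZ (E := dual E)) (comp_fr HdE b a fd) // (negbTE ba) mulr0.
apply: smooth_fun_sum => // al; apply: smooth_funM => //.
  by apply: sub_smooth_fun (sgt a al) => x' [[]].
apply: sub_smooth_fun (smooth_fun_comp HM HN (dfun_smooth h) oVt (sz t ft al)).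
exact: subIsetl.
Qed.

Variable anchor : forall y : N, F y -> tangent y.
Variable br : sect F -> sect F -> sect F.
Hypothesis brP : is_algebroid_bracket (W := fun y => F y) (@smooth_sect R n N p F)
  (fun z f y => tact (anchor (z y)) f) br.

Definition dual_anchor (x : M) (w : dual E x) (f : M -> R) : R :=
  tact (anchor (g x w)) (fun y => f (dinv h y)).

Definition dual_bracket u v : sect (dual E) := gsec_inv g (br (gsec g u) (gsec g v)).

Lemma gsec_bracket u v : gsec g (dual_bracket u v) = br (gsec g u) (gsec g v).
Proof. exact: gsec_invK. Qed.

Lemma g_bracket u v x : g x (dual_bracket u v x) = br (gsec g u) (gsec g v) (h x).
Proof. by rewrite -gsecE gsec_bracket. Qed.

Lemma smooth_dinv V (f : M -> R) : mopen V -> smooth_fun V f ->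
  smooth_fun (dinv h @^-1` V) (fun y => f (dinv h y)).
Proof. exact: (smooth_fun_comp HN HM (dinv_smooth h)). Qed.

(** Restates [dual_anchor] at a point of [N], in the form in which it occurs
    under the composition of two derivations. *)
Lemma dual_anchorE v f y :
  dual_anchor (v (dinv h y)) f = tact (anchor (gsec g v y)) (fun y => f (dinv h y)).
Proof.
by have [x ->] := dfun_onto y; rewrite gsecE dfunK.
Qed.

(** [gsec g] is additive, invertible, and linear over functions when these are
    composed with the inverse of [h]; every axiom is transported along it. *)
Lemma dual_bracketP : is_algebroid_bracket (W := fun x => dual E x)
  (@smooth_sect R m M r (dual E)) (fun u f x => dual_anchor (u x) f) dual_bracket.
Proof.
have Wx V x : V x -> (dinv h @^-1` V) (h x) by rewrite /= dfunK.
split.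
- move=> V u v oV su sv.
  have -> : V = h @^-1` (dinv h @^-1` V) by apply/seteqP; split=> x /=; rewrite dfunK.
  apply: smooth_gsec_inv; first exact: mopen_dinv.
  by apply: (br_sec brP); [exact: mopen_dinv|exact: smooth_gsec|exact: smooth_gsec].
- move=> V u u' v v' oV su su' sv sv' uu' vv' x Vx.
  rewrite /dual_bracket /gsec_inv; congr (_ _).
  apply: (br_restr brP (mopen_dinv oV)); try exact: smooth_gsec; last exact: Wx.
  + by move=> y; have [x' ->] := dfun_onto y; rewrite /= dfunK !gsecE => /uu' ->.
  + by move=> y; have [x' ->] := dfun_onto y; rewrite /= dfunK !gsecE => /vv' ->.
- move=> V u u' v oV su su' sv x Vx; rewrite /dual_bracket /gsec_inv gsecD.
  by rewrite (br_add brP (mopen_dinv oV) (smooth_gsec oV su) (smooth_gsec oV su')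
    (smooth_gsec oV sv) (Wx _ _ Vx)) linearD.
- move=> V a u v oV su sv x Vx; rewrite /dual_bracket /gsec_inv (gsecZ (fun=> a)).
  by rewrite (br_scale brP _ (mopen_dinv oV) (smooth_gsec oV su) (smooth_gsec oV sv)
    (Wx _ _ Vx)) linearZ.
- move=> V u v oV su sv x Vx; rewrite /dual_bracket /gsec_inv.
  by rewrite (br_anti brP (mopen_dinv oV) (smooth_gsec oV su) (smooth_gsec oV sv)
    (Wx _ _ Vx)) linearN.
- move=> V u v w oV su sv sw x Vx.
  have := br_jacobi brP (mopen_dinv oV) (smooth_gsec oV su) (smooth_gsec oV sv)
    (smooth_gsec oV sw) (Wx _ _ Vx).
  move/(congr1 (fun z0 : F (h x) => ((g x)^-1)%VF z0)); rewrite linear0 !linearD => <-.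
  have brE u' v' : dual_bracket u' v' x = ((g x)^-1)%VF (br (gsec g u') (gsec g v') (h x)) by [].
  by rewrite !brE !gsec_bracket.
- move=> V f u v oV sf su sv x Vx; rewrite /dual_bracket /gsec_inv gsecZ.
  rewrite (br_leibniz brP (mopen_dinv oV) (smooth_dinv oV sf) (smooth_gsec oV su)
    (smooth_gsec oV sv) (Wx _ _ Vx)).
  by rewrite linearD !linearZ dfunK !gsecE /= gK.
- move=> V f u v oV sf su sv x Vx; rewrite [LHS]/dual_anchor g_bracket.
  rewrite (br_anchor brP (mopen_dinv oV) (smooth_dinv oV sf) (smooth_gsec oV su)
    (smooth_gsec oV sv) (Wx _ _ Vx)) !gsecE.
  have actE (w : sect (dual E)) : (fun y => tact (anchor (gsec g w y)) (fun y => f (dinv h y))) =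
      (fun y => dual_anchor (w (dinv h y)) f).
    by apply/funext => y; rewrite dual_anchorE.
  exact: (congr2 (fun f1 f2 => tact (anchor (g x (u x))) f1 -
    tact (anchor (g x (v x))) f2) (actE v) (actE u)).
Qed.

(** The Leibniz rule applied to the expansion of [v] in the dual frame; the
    last term is the anchor acting on the components of [v]. *)
Lemma dual_bracket_comp V s u v b x : mopen V -> frames s -> V `<=` fdom s ->
  smooth_sect V u -> smooth_sect V v -> V x ->
  comp (dual_frame s) b (dual_bracket u v x) =
  \sum_a comp (dual_frame s) a (v x) *
          comp (dual_frame s) b (dual_bracket u (fr (dual_frame s) a) x) +
  dual_anchor (u x) (fun y => comp (dual_frame s) b (v y)).
Proof.
move=> oV fs Vs su sv Vx.
have fd : @frames _ _ _ _ (dual E) (dual_frame s) by exists s.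
have sf a : smooth_sect V (fr (dual_frame s) a : sect (dual E)).
  by apply: sub_smooth_sect (smooth_sect_fr HdE a fd); exact: Vs.
have sc a := smooth_sect_comp (E := dual E) a fd Vs sv.
rewrite (br_restr dual_bracketP (z' := u) oV su su sv
  (w' := fun x => \sum_a comp (dual_frame s) a (v x) *: fr (dual_frame s) a x) _ _ _ Vx) //.
- rewrite (br_sumr dual_bracketP oV (S := smooth_sect V)) //.
  + rewrite (comp_sum (E := dual E)).
    under eq_bigr do rewrite (compD (E := dual E)) !(compZ (E := dual E)).
    rewrite big_split /=; congr (_ + _).
    rewrite (bigD1 b) //= big1 ?addr0 => [|a ab].
      by rewrite (comp_fr HdE b b fd) ?eqxx ?mulr1 //; exact: Vs.
    by rewrite (comp_fr HdE a b fd) ?(negbTE ab) ?mulr0 //; exact: Vs.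
  + exact: smooth_sect0.
  + by move=> z w; exact: smooth_sectD.
  + by move=> f z; exact: smooth_sectZ.
- apply: (S_sum (S := smooth_sect V) (V := V)) => //.
  + exact: smooth_sect0.
  + by move=> z w; exact: smooth_sectD.
  + by move=> f z; exact: smooth_sectZ.
- by move=> y Vy; apply: (frame_sum HdE (v y) fd); exact: Vs.
Qed.

End transport.

(** * Local sections of the generalized tangent bundle and their anchor *)

Section gt_bundle.
Variables (R : realType) (m p r : nat) (M N : charted R m).
Variables (HM : smooth_atlas M) (HN : smooth_atlas N).
Variables (G : gen_lie_algebroid p M N) (E : bundle M r) (HE : is_vector_bundle E).
Implicit Types (c : chart R M m) (s : lframe E r) (t : lframe (gF G) p).
Implicit Types (z w : sect (gF G)) (e : dual_total E) (x : M).
Implicit Types (X Y : fsect (@gt_fib R m p r M N G E)).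

Let HF : is_vector_bundle (gF G) := gF_bundle G.
Let HT : smooth_atlas (dual_total E) := dual_total_atlas HM HE.

Definition gt_base c s t : set M :=
  (cdom c `&` gh G @^-1` (geta G @^-1` cdom c)) `&` (fdom s `&` gh G @^-1` fdom t).

Lemma gt_domE c s t : gt_dom c s t = @dproj _ _ M r E @^-1` gt_base c s t.
Proof. by apply/seteqP; split=> e [] => [? ? ? ?|[? ?] [? ?]]. Qed.

Lemma mopen_gt_base c s t : admissible (G := G) c s t -> mopen (gt_base c s t).
Proof.
move=> [ac fs ft]; apply: (mopenI HM); apply: (mopenI HM).
- exact: mopen_cdom.
- by apply: mopen_dfun; apply: mopen_dfun; exact: mopen_cdom.
- exact: (frame_open HE).
- by apply: mopen_dfun; exact: (frame_open HF).
Qed.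

Lemma mopen_gt_dom c s t : admissible (G := G) c s t -> mopen (gt_dom c s t).
Proof. by move=> a; rewrite gt_domE; apply: mopen_dproj => //; exact: mopen_gt_base. Qed.

(** The horizontal vector field [rho_al^i d_i] on [M]. *)
Definition hor_deriv c t al (f : M -> R) (x : M) : R :=
  \sum_i rho_comp c t al i (gh G x) * pderiv c i f x.

(** The anchor of [F], read on [M] through [h]. *)
Lemma ganchor_comp c s t U (f : M -> R) x (z : gF G (gh G x)) :
  admissible (G := G) c s t -> gt_base c s t x -> mopen U -> U x -> smooth_fun U f ->
  tact (ganchor z) (fun y => f (dinv (gh G) y)) = \sum_al comp t al z * hor_deriv c t al f x.
Proof.
move=> [ac fs ft] [[cx ex] [sx tx]] oU Ux sf.
have cx' : cdom c (dinv (gh G) (gh G x)) by rewrite dfunK.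
have Ux' : (dinv (gh G) @^-1` U) (gh G x) by rewrite /= dfunK.
rewrite (ganchorE (z : gF G (gh G x)) ac ft tx ex cx' (mopen_dinv oU) Ux'
  (smooth_dinv HM HN (gh G) oU sf)).
apply: eq_bigr => al _; rewrite mulr_sumr; apply: eq_bigr => i _.
have -> : (fun x => f (dinv (gh G) (gh G x))) = f by apply/funext => y; rewrite dfunK.
by rewrite dfunK mulrA.
Qed.

Definition gt_frame c s t (i : 'I_p + 'I_r) : fsect (@gt_fib R m p r M N G E) :=
  match i with inl al => gt_hor c s t al | inr a => gt_ver G c s a end.

(** The local section lying over [z] with vertical components [xi]; both kinds
    of lifts have this form. *)
Definition gt_field c s t z (xi : 'I_r -> dual_total E -> R) :
    fsect (@gt_fib R m p r M N G E) :=
  fun e => \sum_al comp t al (z (gh G (dproj e))) *: gt_hor c s t al e +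
           \sum_a xi a e *: gt_ver G c s a e.

Definition field_coef t z (xi : 'I_r -> dual_total E -> R) (i : 'I_p + 'I_r) e : R :=
  match i with inl al => comp t al (z (gh G (dproj e))) | inr a => xi a e end.

Lemma gt_fieldE c s t z xi :
  gt_field c s t z xi = (fun e => \sum_i field_coef t z xi i e *: gt_frame c s t i e).
Proof. by apply: fsect_eq => e; rewrite big_sumType. Qed.

Section local_frame.
Variables (c : chart R M m) (s : lframe E r) (t : lframe (gF G) p).
Hypothesis A : admissible (G := G) c s t.

Let cdom_e e : gt_dom c s t e -> cdom (dchart c s) e.
Proof. by case. Qed.

Lemma gt_act_hor_base al U (f : M -> R) e :
  gt_dom c s t e -> mopen U -> U (dproj e) -> smooth_fun U f ->
  gt_act (gt_hor c s t al) (fun q => f (dproj q)) e = hor_deriv c t al f (dproj e).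
Proof.
have [ac fs ft] := A; move=> De oU Ux sf; rewrite /gt_act /gt_hor /=.
have sfT := smooth_fun_dproj HM HE oU sf.
rewrite (tact_sum HT _ _ (U := @dproj _ _ M r E @^-1` U)) //.
apply: eq_bigr => i _; rewrite (tactZ HT _ _ (U := @dproj _ _ M r E @^-1` U)) //.
by rewrite (tact_lshift_base HM HE i ac fs (cdom_e De) oU Ux sf).
Qed.

Lemma gt_act_ver_base a U (f : M -> R) e :
  gt_dom c s t e -> mopen U -> U (dproj e) -> smooth_fun U f ->
  gt_act (gt_ver G c s a) (fun q => f (dproj q)) e = 0.
Proof.
have [ac fs ft] := A; move=> De oU Ux sf.
exact: (tact_rshift_base HM HE a ac fs (cdom_e De) oU Ux sf).
Qed.

Let smooth_p a : smooth_fun (@dproj _ _ M r E @^-1` fdom s) (pcoord s a).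
Proof. by have [ac fs ft] := A; exact: smooth_fun_pcoord. Qed.

Lemma gt_act_hor_pcoord al a e : gt_dom c s t e ->
  gt_act (gt_hor c s t al) (pcoord s a) e = 0.
Proof.
have [ac fs ft] := A; move=> De; have [_ _ sx _] := De; rewrite /gt_act /gt_hor /=.
rewrite (tact_sum HT _ _ (U := @dproj _ _ M r E @^-1` fdom s)) //.
apply: big1 => i _; rewrite (tactZ HT _ _ (U := @dproj _ _ M r E @^-1` fdom s)) //.
by rewrite (tact_coordv_pcoord HM HE _ _ ac fs (cdom_e De)) eq_lrshift mulr0.
Qed.

Lemma gt_act_ver_pcoord b a e : gt_dom c s t e ->
  gt_act (gt_ver G c s b) (pcoord s a) e = (b == a)%:R.
Proof.
have [ac fs ft] := A; move=> De; rewrite /gt_act /gt_ver /=.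
by rewrite (tact_coordv_pcoord HM HE _ _ ac fs (cdom_e De)) (inj_eq (@rshift_inj _ _)).
Qed.

Lemma gt_act_frame (k : 'I_p + 'I_r -> dual_total E -> R) V f e : smooth_fun V f -> V e ->
  gt_act (fun q => \sum_i k i q *: gt_frame c s t i q) f e =
  \sum_i k i e * gt_act (gt_frame c s t i) f e.
Proof.
move=> sf Ve; rewrite /gt_act (_ : (\sum_i _).2 = \sum_i k i e *: (gt_frame c s t i e).2).
  rewrite (tact_sum HT _ _ Ve sf); apply: eq_bigr => i _.
  by rewrite (tactZ HT _ _ Ve sf).
by rewrite (raddf_sum (@snd _ _)).
Qed.

(** On functions coming from the base the vertical part acts trivially, and the
    horizontal frame is built so as to act like the anchor of [F]. *)
Lemma gt_act_field_base z xi U (f : M -> R) e :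
  gt_dom c s t e -> mopen U -> U (dproj e) -> smooth_fun U f ->
  gt_act (gt_field c s t z xi) (fun q => f (dproj q)) e =
  tact (ganchor (z (gh G (dproj e)))) (fun y => f (dinv (gh G) y)).
Proof.
move=> De oU Ux sf.
rewrite gt_fieldE (gt_act_frame _ (smooth_fun_dproj HM HE oU sf)) // big_sumType /=.
rewrite [X in _ + X]big1 ?addr0 => [|a _]; last by rewrite (gt_act_ver_base a De oU) ?mulr0.
have De' := De; rewrite gt_domE in De'.
rewrite (ganchor_comp _ A De' oU Ux sf); apply: eq_bigr => al _.
by rewrite (gt_act_hor_base al De oU).
Qed.

(** The horizontal frame elements are coordinate fields along the base, so they
    annihilate the fibre coordinates. *)
Lemma gt_act_field_pcoord z xi a e : gt_dom c s t e ->
  gt_act (gt_field c s t z xi) (pcoord s a) e = xi a e.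
Proof.
move=> De; have [_ _ sx _] := De.
rewrite gt_fieldE (gt_act_frame _ (smooth_p a)) // big_sumType /=.
rewrite big1 ?add0r => [|al _]; last by rewrite gt_act_hor_pcoord ?mulr0.
rewrite (bigD1 a) // big1 => [|b ba].
  by rewrite [LHS]addr0 gt_act_ver_pcoord // eqxx mulr1.
by rewrite gt_act_ver_pcoord // (negbTE ba) mulr0.
Qed.

End local_frame.
End gt_bundle.

(** * The bracket of two local sections *)

Section field_bracket.
Variables (R : realType) (m p r : nat) (M N : charted R m).
Variables (HM : smooth_atlas M) (HN : smooth_atlas N).
Variables (G : gen_lie_algebroid p M N) (E : bundle M r) (HE : is_vector_bundle E).
Implicit Types (c : chart R M m) (s : lframe E r) (t : lframe (gF G) p).
Implicit Types (z w : sect (gF G)) (e : dual_total E) (x : M).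
Implicit Types (X Y : fsect (@gt_fib R m p r M N G E)).

Let HF : is_vector_bundle (gF G) := gF_bundle G.

Lemma ganchor_sum (W : set N) (f : N -> R) y (I : Type) (q : seq I) (k : I -> R)
    (z : I -> gF G y) : mopen W -> W y -> smooth_fun W f ->
  tact (ganchor (\sum_(i <- q) k i *: z i)) f = \sum_(i <- q) k i * tact (ganchor (z i)) f.
Proof.
move=> oW Wy sf; have [ac ce ch] := gchartP G y; have [ft ty] := frame_atP HF y.
rewrite (ganchorE _ ac ft ty ce ch oW Wy sf).
under eq_bigr do (under eq_bigr do rewrite comp_sum !mulr_suml; rewrite exchange_big).
rewrite exchange_big /=; apply: eq_bigr => i _.
rewrite (ganchorE _ ac ft ty ce ch oW Wy sf) mulr_sumr; apply: eq_bigr => al _.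
by rewrite mulr_sumr; apply: eq_bigr => j _; rewrite compZ !mulrA.
Qed.

Lemma ganchor0 (W : set N) (f : N -> R) y : mopen W -> W y -> smooth_fun W f ->
  tact (ganchor (0 : gF G y)) f = 0.
Proof.
move=> oW Wy sf; have := ganchor_sum [::] (fun i : unit => 0) (fun=> 0 : gF G y) oW Wy sf.
by rewrite !big_nil.
Qed.

(** The counterpart on [N] of the horizontal part of [gt_bracket_field]. *)
Lemma gbr_comp W t z w ga y : mopen W -> frames t -> W `<=` fdom t ->
  smooth_sect W z -> smooth_sect W w -> W y ->
  comp t ga (gbr z w y) =
  \sum_al \sum_be comp t al (z y) * comp t be (w y) * struct_fun t al be ga y +
  (tact (ganchor (z y)) (fun y => comp t ga (w y)) -
   tact (ganchor (w y)) (fun y => comp t ga (z y))).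
Proof.
move=> oW ft Wt sz sw Wy.
have sf al : smooth_sect W (fr t al).
  by apply: sub_smooth_sect (smooth_sect_fr HF al ft); exact: Wt.
have S0 : smooth_sect W (fun=> 0 : gF G _) by exact: smooth_sect0.
have SD z' w' : smooth_sect W z' -> smooth_sect W w' ->
    smooth_sect W (fun y => z' y + w' y).
  exact: (smooth_sectD HN HF oW).
have SZ f z' : smooth_fun W f -> smooth_sect W z' -> smooth_sect W (fun y => f y *: z' y).
  exact: (smooth_sectZ HN HF oW).
have cz al := smooth_sect_comp al ft Wt sz.
have cw al := smooth_sect_comp al ft Wt sw.
have zE y' : W y' -> z y' = \sum_al comp t al (z y') *: fr t al y'.
  by move=> Wy'; apply: (frame_sum HF (z y') ft); exact: Wt.
have wE y' : W y' -> w y' = \sum_al comp t al (w y') *: fr t al y'.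
  by move=> Wy'; apply: (frame_sum HF (w y') ft); exact: Wt.
have sz' := S_sum S0 SD SZ (index_enum 'I_p) cz sf.
have sw' := S_sum S0 SD SZ (index_enum 'I_p) cw sf.
rewrite (br_restr (gbrP G) oW sz sz' sw sw' zE wE Wy).
rewrite (br_frame (gbrP G) oW (S := smooth_sect W)) //; last first.
  by move=> phi sphi; rewrite (ganchor_sum _ _ _ oW Wy sphi).
rewrite -(zE _ Wy) -(wE _ Wy) compD !comp_sum; congr (_ + _).
  apply: eq_bigr => al _; rewrite comp_sum; apply: eq_bigr => be _.
  by rewrite compZ.
rewrite (bigD1 ga) //= big1 ?addr0 => [|al ag].
  by rewrite compZ (comp_fr HF ga ga ft) ?eqxx ?mulr1 //; exact: Wt.
by rewrite compZ (comp_fr HF al ga ft) ?(negbTE ag) ?mulr0 //; exact: Wt.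
Qed.

Section local_frame.
Variables (c : chart R M m) (s : lframe E r) (t : lframe (gF G) p).
Hypothesis A : admissible (G := G) c s t.

(** The smooth combinations of one fixed local frame. *)
Definition gt_comb X := exists k : 'I_p + 'I_r -> dual_total E -> R,
  (forall i, smooth_fun (gt_dom c s t) (k i)) /\
  X = (fun e => \sum_i k i e *: gt_frame c s t i e).

Let oD : mopen (gt_dom c s t) := mopen_gt_dom HM HE A.

Lemma gt_comb_sect X : gt_comb X -> gt_sect (gt_dom c s t) X.
Proof.
move=> [k [sk ->]] e De; exists c, s, t, (gt_dom c s t), (fun al => k (inl al)),
  (fun a => k (inr a)); split; first by split.
by split=> [al|a|e' _]; [exact: sk|exact: sk|rewrite big_sumType].
Qed.

Lemma gt_comb0 : gt_comb (fun=> 0).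
Proof.
exists (fun _ _ => 0); split=> [i|]; first exact: smooth_fun_cst.
by apply: fsect_eq => e; rewrite big1 // => i _; rewrite scale0r.
Qed.

Lemma gt_combD X Y : gt_comb X -> gt_comb Y -> gt_comb (fun e => X e + Y e).
Proof.
move=> [k [sk ->]] [l [sl ->]]; exists (fun i e => k i e + l i e); split=> [i|].
  exact: (smooth_funD oD (sk i) (sl i)).
apply: fsect_eq => e; rewrite -big_split; apply: eq_bigr => i _.
by rewrite scalerDl.
Qed.

Lemma gt_combZ f X : smooth_fun (gt_dom c s t) f -> gt_comb X ->
  gt_comb (fun e => f e *: X e).
Proof.
move=> sf [k [sk ->]]; exists (fun i e => f e * k i e); split=> [i|].
  exact: (smooth_funM oD sf (sk i)).
apply: fsect_eq => e; rewrite scaler_sumr; apply: eq_bigr => i _.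
by rewrite scalerA.
Qed.

Lemma gt_comb_frame i : gt_comb (gt_frame c s t i).
Proof.
exists (fun j _ => (j == i)%:R); split=> [j|]; first exact: smooth_fun_cst.
apply: fsect_eq => e; rewrite (bigD1 i) //= eqxx scale1r big1 ?addr0 // => j ji.
by rewrite (negbTE ji) scale0r.
Qed.

Definition base_in_N : set N := dinv (gh G) @^-1` gt_base c s t.

Lemma mopen_base_in_N : mopen base_in_N.
Proof. by apply: mopen_dinv; exact: mopen_gt_base. Qed.

Lemma base_in_N_fdom : base_in_N `<=` fdom t.
Proof. by move=> y [_ [_]] /=; rewrite dinvK. Qed.

Lemma base_in_N_proj e : gt_dom c s t e -> base_in_N (gh G (dproj e)).
Proof. by rewrite gt_domE /base_in_N /= dfunK. Qed.

Lemma smooth_comp_h z al : smooth_sect base_in_N z ->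
  smooth_fun (gt_base c s t) (fun x => comp t al (z (gh G x))).
Proof.
have [ac fs ft] := A; move=> sz.
have sc := smooth_sect_comp al ft base_in_N_fdom sz.
apply: sub_smooth_fun (smooth_fun_comp HM HN (dfun_smooth (gh G)) mopen_base_in_N sc).
by move=> x Bx; rewrite /= /base_in_N /= dfunK.
Qed.

Lemma smooth_field_coef z xi i : smooth_sect base_in_N z ->
  (forall a, smooth_fun (gt_dom c s t) (xi a)) ->
  smooth_fun (gt_dom c s t) (field_coef t z xi i).
Proof.
move=> sz sx; case: i => [al|a]; last exact: sx.
rewrite gt_domE.
exact: (smooth_fun_dproj HM HE (mopen_gt_base HM HE A) (smooth_comp_h al sz)).
Qed.

Lemma gt_comb_field z xi : smooth_sect base_in_N z ->
  (forall a, smooth_fun (gt_dom c s t) (xi a)) -> gt_comb (gt_field c s t z xi).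
Proof.
move=> sz sx; exists (field_coef t z xi); split; last exact: gt_fieldE.
by move=> i; exact: smooth_field_coef.
Qed.

Variable B : fsect (@gt_fib R m p r M N G E) -> fsect (@gt_fib R m p r M N G E) ->
  fsect (@gt_fib R m p r M N G E).
Hypothesis HB : is_gt_bracket B.

(** Of the brackets of frame elements only the horizontal ones contribute, with
    the structure functions of [F].  Together with the derivatives of the
    horizontal components, which are taken by the anchors of [z] and [w], they
    add up to the components of [gbr z w]. *)
Lemma gt_bracket_field z w xi zeta e :
  smooth_sect base_in_N z -> smooth_sect base_in_N w ->
  (forall a, smooth_fun (gt_dom c s t) (xi a)) ->
  (forall a, smooth_fun (gt_dom c s t) (zeta a)) -> gt_dom c s t e ->
  B (gt_field c s t z xi) (gt_field c s t w zeta) e =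
  gt_field c s t (gbr z w) (fun a q =>
    gt_act (gt_field c s t z xi) (zeta a) q - gt_act (gt_field c s t w zeta) (xi a) q) e.
Proof.
move=> sz sw sx sy De; have [ac fs ft] := A.
have HBP := gt_bracketP HB.
have cz i := smooth_field_coef i sz sx; have cw i := smooth_field_coef i sw sy.
rewrite {1}(gt_fieldE c s t z xi) {1}(gt_fieldE c s t w zeta).
rewrite (br_frame HBP oD (S := gt_comb) gt_comb_sect gt_comb0 gt_combD gt_combZ
  (f := gt_frame c s t) (xi := field_coef t z xi) (y := field_coef t w zeta)
  gt_comb_frame cz cw De); last first.
  by move=> phi sphi; exact: (gt_act_frame HM HE c s t _ sphi De).
rewrite -!gt_fieldE !big_sumType /=.
have hv al b : B (gt_hor c s t al) (gt_ver G c s b) e = 0 by exact: (gt_bracket_hv HB A).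
have vh al b : B (gt_ver G c s b) (gt_hor c s t al) e = 0.
  have := br_anti HBP oD (gt_comb_sect (gt_comb_frame (inr b)))
    (gt_comb_sect (gt_comb_frame (inl al))) De.
  by rewrite /= hv oppr0.
have vv a b : B (gt_ver G c s a) (gt_ver G c s b) e = 0 by exact: (gt_bracket_vv HB A).
rewrite [X in _ + X + _]big1 ?addr0 => [|a _]; last first.
  by rewrite big_sumType /= !big1 ?addr0 // => i _; rewrite ?vh ?vv scaler0.
rewrite addrA; congr (_ + _).
have Be := base_in_N_proj De.
have actE z' w' xi' al : smooth_sect base_in_N w' ->
    gt_act (gt_field c s t z' xi') (field_coef t w' zeta (inl al)) e =
    tact (ganchor (z' (gh G (dproj e)))) (fun y => comp t al (w' y)).
  move=> sw'; have De' := De; rewrite gt_domE in De'.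
  rewrite (gt_act_field_base HM HN HE A z' xi' De (mopen_gt_base HM HE A) De'
    (smooth_comp_h al sw')).
  by congr (tact _ _); apply/funext => y; rewrite dinvK.
under [in RHS]eq_bigr do
  rewrite (gbr_comp _ mopen_base_in_N ft base_in_N_fdom sz sw Be) scalerDl.
rewrite [RHS]big_split; congr (_ + _); last first.
  apply: eq_bigr => al _; rewrite actE //; congr ((_ - _) *: _).
  exact: actE.
under [in RHS]eq_bigr do rewrite scaler_suml.
rewrite [RHS]exchange_big; apply: eq_bigr => al _.
under [in RHS]eq_bigr do rewrite scaler_suml.
rewrite [RHS]exchange_big big_sumType /= [X in _ + X]big1 ?addr0 => [|b _]; last first.
  by rewrite hv scaler0.
apply: eq_bigr => be _; rewrite (gt_bracket_hh HB A al be De) scaler_sumr.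
by apply: eq_bigr => ga _; rewrite scalerA.
Qed.

End local_frame.
End field_bracket.

(** * Vertical and complete lifts *)

Section lifts.
Variables (R : realType) (m p r : nat) (M N : charted R m).
Variables (HM : smooth_atlas M) (HN : smooth_atlas N).
Variables (G : gen_lie_algebroid p M N) (E : bundle M r) (HE : is_vector_bundle E).
Variables (g : bmorphism (gh G) (dual E) (gF G)) (Hg : locally_invertible g).
Implicit Types (c : chart R M m) (s : lframe E r) (t : lframe (gF G) p).
Implicit Types (z w : sect (gF G)) (e : dual_total E) (x : M) (u v : sect (dual E)).
Implicit Types (X Y : fsect (@gt_fib R m p r M N G E)).

Let HF : is_vector_bundle (gF G) := gF_bundle G.
Let HT : smooth_atlas (dual_total E) := dual_total_atlas HM HE.
Let HdE : is_vector_bundle (dual E) := dual_vector_bundle HM HE.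

(** The bracket on [E^*] carried over from [F], and its anchor. *)
Definition ebr u v : sect (dual E) := dual_bracket g (@gbr _ _ _ _ _ G) u v.
Definition eanchor x (w : dual E x) (f : M -> R) : R :=
  dual_anchor g (@ganchor _ _ _ _ _ G) w f.

Lemma ebrP : is_algebroid_bracket (W := fun x => dual E x)
  (@smooth_sect R m M r (dual E)) (fun u f x => eanchor (u x) f) ebr.
Proof. exact: (dual_bracketP HM HN HE HF Hg (gbrP G)). Qed.

(** The matrix of the derivation [ebr u] in the dual frame of [s]. *)
Definition ebr_coef s u a b x : R :=
  comp (dual_frame s) b (ebr u (fr (dual_frame s) a) x).

Lemma ebr_comp V s u v b x : mopen V -> frames s -> V `<=` fdom s ->
  smooth_sect V u -> smooth_sect V v -> V x ->
  comp (dual_frame s) b (ebr u v x) =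
  \sum_a comp (dual_frame s) a (v x) * ebr_coef s u a b x +
  eanchor (u x) (fun y => comp (dual_frame s) b (v y)).
Proof. exact: (dual_bracket_comp HM HN HE HF Hg (gbrP G)). Qed.

Lemma smooth_dual_fr V s a : frames s -> V `<=` fdom s ->
  smooth_sect V (fr (dual_frame s) a : sect (dual E)).
Proof.
move=> fs Vs; have fd : @frames _ _ _ _ (dual E) (dual_frame s) by exists s.
by apply: sub_smooth_sect (smooth_sect_fr HdE a fd); exact: Vs.
Qed.

Lemma smooth_dual_comp V s u a : frames s -> V `<=` fdom s -> smooth_sect V u ->
  smooth_fun V (fun x => comp (dual_frame s) a (u x)).
Proof.
move=> fs Vs su; have fd : @frames _ _ _ _ (dual E) (dual_frame s) by exists s.
exact: (smooth_sect_comp (E := dual E) a fd Vs su).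
Qed.

Lemma smooth_ebr V u v : mopen V -> smooth_sect V u -> smooth_sect V v ->
  smooth_sect V (ebr u v).
Proof. exact: (br_sec ebrP). Qed.

Lemma smooth_ebr_coef V s u a b : mopen V -> frames s -> V `<=` fdom s ->
  smooth_sect V u -> smooth_fun V (ebr_coef s u a b).
Proof.
move=> oV fs Vs su; apply: smooth_dual_comp => //.
by apply: smooth_ebr => //; exact: smooth_dual_fr.
Qed.

(** The Jacobi identity for [u], [v] and an element of the dual frame, the inner
    brackets being expanded in that frame. *)
Lemma ebr_coef_bracket V s u v a b x : mopen V -> frames s -> V `<=` fdom s ->
  smooth_sect V u -> smooth_sect V v -> V x ->
  ebr_coef s (ebr u v) a b x =
  (\sum_d ebr_coef s v a d x * ebr_coef s u d b x + eanchor (u x) (ebr_coef s v a b)) -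
  (\sum_d ebr_coef s u a d x * ebr_coef s v d b x + eanchor (v x) (ebr_coef s u a b)).
Proof.
move=> oV fs Vs su sv Vx; have sa := smooth_dual_fr a fs Vs.
have sva := smooth_ebr oV sv sa; have sua := smooth_ebr oV su sa.
rewrite -(ebr_comp b oV fs Vs su sva Vx) -(ebr_comp b oV fs Vs sv sua Vx).
have J := br_jacobi ebrP oV su sv sa Vx.
have e1 := br_anti ebrP oV sa (smooth_ebr oV su sv) Vx.
have e2 : ebr v (ebr (fr (dual_frame s) a) u) x = - ebr v (ebr u (fr (dual_frame s) a)) x.
  have sau := smooth_ebr oV sa su.
  rewrite (br_anti ebrP oV sv sau Vx) [in RHS](br_anti ebrP oV sv sua Vx).
  have sN : smooth_sect V (fun y => (-1) *: ebr u (fr (dual_frame s) a) y : dual E y).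
    by apply: (smooth_sectZ HM HdE oV) sua; exact: smooth_fun_cst.
  rewrite (br_restr ebrP oV sau sN sv sv _ _ Vx) //; last first.
    by move=> y Vy; rewrite scaleN1r; exact: (br_anti ebrP oV sa su Vy).
  by rewrite (br_scale ebrP _ oV sua sv Vx) scaleN1r.
rewrite /ebr_coef; move: J; rewrite e1 e2.
move/eqP; rewrite addr_eq0 opprK addrC => /eqP <-.
by rewrite addrC (compD (E := dual E)) -scaleN1r (compZ (E := dual E)) mulN1r.
Qed.

Definition vlift_coef s u a e : R := comp (dual_frame s) a (u (dproj e)).

Definition clift_coef s u b e : R :=
  - \sum_a pcoord s a e * ebr_coef s u a b (dproj e).

Lemma vlift_locE c s t u e :
  vlift_loc G c s u e = gt_field c s t (fun=> 0) (vlift_coef s u) e.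
Proof.
rewrite /gt_field big1 ?add0r // => al _.
by rewrite /comp linear0 scale0r.
Qed.

Lemma clift_locE c s t u e : admissible (G := G) c s t -> gt_dom c s t e ->
  clift_loc g c s t u e = gt_field c s t (gsec g u) (clift_coef s u) e.
Proof.
move=> [ac fs ft] [cx ex sx tx]; rewrite /clift_loc /gt_field; congr (_ + _).
  apply: eq_bigr => al _; congr (_ *: _).
  by rewrite gsecE (comp_g HM HE g t al (u (dproj e)) fs sx).
rewrite -sumrN; apply: eq_bigr => b _; rewrite -scaleNr; congr (- _ *: _).
apply: eq_bigr => a _; rewrite /ebr_coef /ebr /dual_bracket /gsec_inv.
rewrite [in RHS](frame_sum HF (gbr _ _ _) ft tx) linear_sum (comp_sum (E := dual E)).
rewrite mulr_sumr; apply: eq_bigr => ga _.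
by rewrite linearZ (compZ (E := dual E)) mulrA.
Qed.

Lemma gt_field_eq c s t z z' xi xi' e : z (gh G (dproj e)) = z' (gh G (dproj e)) ->
  (forall a, xi a e = xi' a e) -> gt_field c s t z xi e = gt_field c s t z' xi' e.
Proof.
move=> zz xx; rewrite /gt_field zz; congr (_ + _).
by apply: eq_bigr => a _; rewrite xx.
Qed.

Lemma gt_field_fst c s t z xi e : admissible (G := G) c s t -> gt_dom c s t e ->
  (gt_field c s t z xi e).1 = z (gh G (dproj e)).
Proof.
move=> [ac fs ft] [cx ex sx tx]; rewrite /gt_field /=.
rewrite (raddf_sum (@fst _ _)) (raddf_sum (@fst _ _)) [X in _ + X]big1 => [|a _].
  by rewrite addr0 [RHS](frame_sum HF _ ft tx).
exact: scaler0.
Qed.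

(** Two local expressions over the same section of [F] agree at [e] as soon as
    their vertical components are related by the rule of
    [tact_pcoord_change]. *)
Lemma gt_field_change c s t c' s' t' z xi xi' e :
  admissible (G := G) c s t -> admissible (G := G) c' s' t' ->
  gt_dom c s t e -> gt_dom c' s' t' e ->
  (forall a, xi a e = \sum_b (pcoord s' b e *
      tact (ganchor (z (gh G (dproj e)))) (fun y => comp s' b (fr s a (dinv (gh G) y))) +
      comp s' b (fr s a (dproj e)) * xi' b e)) ->
  gt_field c s t z xi e = gt_field c' s' t' z xi' e.
Proof.
move=> A A' De De' xE; have [_ fs _] := A; have [_ _ sx _] := De.
have [_ fs' _] := A'; have [_ _ sx' _] := De'.
apply: injective_projections.
  exact: etrans (gt_field_fst z xi A De) (esym (gt_field_fst z xi' A' De')).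
apply: (dual_tangent_eq HM HE fs sx) => [U f oU Ux sf|a].
  rewrite [LHS](gt_act_field_base HM HN HE A z xi De oU Ux sf).
  by rewrite [RHS](gt_act_field_base HM HN HE A' z xi' De' oU Ux sf).
rewrite [LHS](gt_act_field_pcoord HM HE A z xi a De) xE.
rewrite [RHS](tact_pcoord_change HM HE a _ fs' fs sx' sx); apply: eq_bigr => b _.
have oU : mopen (fdom s `&` fdom s') by apply: (mopenI HM); exact: (frame_open HE).
have := gt_act_field_base HM HN HE A' z xi' De' oU (conj sx sx')
  (frame_smooth HE fs fs' a b).
rewrite /gt_act => ->.
by have := gt_act_field_pcoord HM HE A' z xi' b De'; rewrite /gt_act => ->.
Qed.

Lemma dual_comp_change s s' a x (w : dual E x) : frames s -> frames s' ->
  fdom s x -> fdom s' x ->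
  comp (dual_frame s) a w = \sum_b comp s' b (fr s a x) * comp (dual_frame s') b w.
Proof.
move=> fs fs' sx sx'; rewrite (dual_comp HE) //.
rewrite {1}(frame_sum HE (fr s a x) fs' sx') linear_sum.
by apply: eq_bigr => b _; rewrite linearZ (dual_comp HE).
Qed.

Lemma eq_eanchor U x (w : dual E x) (f f' : M -> R) : mopen U -> U x ->
  (forall y, U y -> f y = f' y) -> eanchor w f = eanchor w f'.
Proof.
move=> oU Ux ff; apply: (eq_tact HN _ (mopen_dinv (h := gh G) oU)).
  by rewrite /= dfunK.
by move=> y Uy; exact: ff.
Qed.

(** The inhomogeneous term in the change of frame of the fibre coordinates
    cancels against the one produced by the Leibniz rule, when the elements of
    one dual frame are expanded in the other. *)
Lemma clift_coef_change s s' u a e : smooth_sect setT u -> frames s -> frames s' ->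
  fdom s (dproj e) -> fdom s' (dproj e) ->
  clift_coef s u a e = \sum_b (pcoord s' b e *
      eanchor (u (dproj e)) (fun x => comp s' b (fr s a x)) +
      comp s' b (fr s a (dproj e)) * clift_coef s' u b e).
Proof.
move=> su fs fs' sx sx'; set x := dproj e.
pose U := fdom s `&` fdom s'.
have oU : mopen U by apply: (mopenI HM); exact: (frame_open HE).
have Ux : U x by [].
have suU : smooth_sect U u by exact: sub_smooth_sect su.
have Us : U `<=` fdom s by exact: subIsetl.
have Us' : U `<=` fdom s' by exact: subIsetr.
have key d : \sum_b comp s' b (fr s a x) * ebr_coef s' u d b x =
    \sum_b comp s' d (fr s b x) * ebr_coef s u b a x +
    eanchor (u x) (fun y => comp s' d (fr s a y)).
  rewrite -dual_comp_change //.
  rewrite (ebr_comp _ oU fs Us suU (smooth_dual_fr d fs' Us') Ux); congr (_ + _).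
    by apply: eq_bigr => b _; rewrite (dual_comp HE) // dual_frE.
  by apply: (eq_eanchor _ oU Ux) => y [sy _]; rewrite (dual_comp HE) // dual_frE.
rewrite big_split /= [X in _ + X](_ : _ = - \sum_d pcoord s' d e *
    \sum_b comp s' b (fr s a x) * ebr_coef s' u d b x); last first.
  rewrite -sumrN; under eq_bigr do rewrite mulrN mulr_sumr -sumrN.
  rewrite exchange_big /=; apply: eq_bigr => d _; rewrite mulr_sumr -sumrN.
  by apply: eq_bigr => b _; rewrite mulrCA.
under [X in _ - X]eq_bigr do rewrite key mulrDr mulr_sumr.
rewrite big_split /= opprD addrCA subrr addr0 exchange_big /=; congr (- _).
apply: eq_bigr => b _; rewrite (pcoord_change HE s b fs' sx') mulr_suml.
by apply: eq_bigr => d _; rewrite mulrA.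
Qed.

(** The local data used at [e] in the definition of the lifts. *)
Lemma ref_admissible e :
  admissible (G := G) (gchart G (gh G (dproj e))) (frame_at E (dproj e))
    (frame_at (gF G) (gh G (dproj e))) /\
  gt_dom (gchart G (gh G (dproj e))) (frame_at E (dproj e))
    (frame_at (gF G) (gh G (dproj e))) e.
Proof.
have [ac ce ch] := gchartP G (gh G (dproj e)).
have [fs sx] := frame_atP HE (dproj e).
have [ft tx] := frame_atP HF (gh G (dproj e)).
by split=> //; split=> //; rewrite -[X in cdom _ X](dfunK (gh G)).
Qed.

(** The vertical lift lies over the zero section, whose anchor vanishes, so
    that its components simply change like those of [u]. *)
Lemma vlift_field c s t u e : admissible (G := G) c s t -> gt_dom c s t e ->
  vlift G u e = gt_field c s t (fun=> 0) (vlift_coef s u) e.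
Proof.
move=> A De; have [A' De'] := ref_admissible e.
have [_ fs _] := A; have [_ _ sx _] := De.
have [_ fs' _] := A'; have [_ _ sx' _] := De'.
rewrite /vlift (vlift_locE _ _ (frame_at (gF G) (gh G (dproj e)))).
apply: (gt_field_change A' A De' De) => a.
rewrite /vlift_coef (dual_comp_change a _ fs' fs sx' sx); apply: eq_bigr => b _.
have oU : mopen (fdom (frame_at E (dproj e)) `&` fdom s).
  by apply: (mopenI HM); exact: (frame_open HE).
have sU := smooth_dinv HM HN (gh G) oU (frame_smooth HE fs' fs a b).
by rewrite (ganchor0 G (mopen_dinv (h := gh G) oU) _ sU) /= ?dfunK // mulr0 add0r.
Qed.

Lemma clift_field c s t u e : smooth_sect setT u ->
  admissible (G := G) c s t -> gt_dom c s t e ->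
  clift g u e = gt_field c s t (gsec g u) (clift_coef s u) e.
Proof.
move=> su A De; have [A' De'] := ref_admissible e.
have [_ fs _] := A; have [_ _ sx _] := De.
have [_ fs' _] := A'; have [_ _ sx' _] := De'.
rewrite /clift (clift_locE u A' De'); apply: (gt_field_change A' A De' De) => a.
rewrite (clift_coef_change a su fs' fs sx' sx); apply: eq_bigr => b _.
by rewrite gsecE.
Qed.

Lemma gt_sect_eq (V : set (dual_total E)) X Y : mopen V ->
  (forall e, V e -> X e = Y e) -> gt_sect V Y -> gt_sect V X.
Proof.
move=> oV XY sY e Ve; have [c [s [t [U [k [l [[AU oU Ue UD] [sk sl YE]]]]]]]] := sY e Ve.
exists c, s, t, (U `&` V), k, l; split.
  by split=> //; [exact: (mopenI HT)|move=> e' [Ue' _]; exact: UD].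
split=> [al|a|e' [Ue' Ve']].
- by apply: sub_smooth_fun (sk al); exact: subIsetl.
- by apply: sub_smooth_fun (sl a); exact: subIsetl.
- by rewrite XY // YE.
Qed.

Section local_frame.
Variables (c : chart R M m) (s : lframe E r) (t : lframe (gF G) p).
Hypothesis A : admissible (G := G) c s t.

Let D := gt_dom c s t.
Let Bs := gt_base c s t.
Let oD : mopen D := mopen_gt_dom HM HE A.
Let oB : mopen Bs := mopen_gt_base HM HE A.
Let fs : frames s. Proof. by case: A. Qed.
Let Bs_s : Bs `<=` fdom s. Proof. by move=> x [_ []]. Qed.

Let base_e e : D e -> Bs (dproj e). Proof. by rewrite /D gt_domE. Qed.

Lemma smooth_vlift_coef u a : smooth_sect setT u -> smooth_fun D (vlift_coef s u a).
Proof.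
move=> su; rewrite /D gt_domE.
have suB := sub_smooth_sect (@subsetT _ Bs) su.
exact: (smooth_fun_dproj HM HE oB (smooth_dual_comp a fs Bs_s suB)).
Qed.

Let smooth_phi u a b : smooth_sect setT u -> smooth_fun Bs (ebr_coef s u a b).
Proof. by move=> su; apply: smooth_ebr_coef => //; exact: sub_smooth_sect su. Qed.

Let smooth_p a : smooth_fun D (pcoord s a).
Proof. by apply: sub_smooth_fun (smooth_fun_pcoord HM HE a fs) => e []. Qed.

Let smooth_phi_D u a b : smooth_sect setT u ->
  smooth_fun D (fun e => ebr_coef s u a b (dproj e)).
Proof.
by move=> su; rewrite /D gt_domE; exact: (smooth_fun_dproj HM HE oB (smooth_phi a b su)).
Qed.

Lemma smooth_clift_coef u b : smooth_sect setT u -> smooth_fun D (clift_coef s u b).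
Proof.
move=> su; apply: (smooth_funN oD); apply: (smooth_fun_sum _ oD) => a.
by apply: smooth_funM => //; exact: smooth_phi_D.
Qed.

Lemma gt_act_vlift_coef z xi u a e : smooth_sect setT u -> D e ->
  gt_act (gt_field c s t z xi) (vlift_coef s u a) e =
  tact (ganchor (z (gh G (dproj e))))
    (fun y => comp (dual_frame s) a (u (dinv (gh G) y))).
Proof.
move=> su De; have suB := sub_smooth_sect (@subsetT _ Bs) su.
exact: (gt_act_field_base HM HN HE A z xi De oB (base_e De)
  (smooth_dual_comp a fs Bs_s suB)).
Qed.

(** The product rule for the terms [pcoord s a * ebr_coef s u a b]. *)
Lemma gt_act_clift_coef z xi u b e : smooth_sect setT u -> D e ->
  gt_act (gt_field c s t z xi) (clift_coef s u b) e =
  - \sum_a (pcoord s a e * tact (ganchor (z (gh G (dproj e))))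
                             (fun y => ebr_coef s u a b (dinv (gh G) y)) +
            ebr_coef s u a b (dproj e) * xi a e).
Proof.
move=> su De; have sM a : smooth_fun D (fun q => pcoord s a q * ebr_coef s u a b (dproj q)).
  by apply: smooth_funM => //; exact: smooth_phi_D.
rewrite /gt_act (tact_funN HT _ De (smooth_fun_sum _ oD sM)).
rewrite (tact_fun_sum HT _ _ oD De sM); congr (- _); apply: eq_bigr => a _.
rewrite (tact_funM HT _ De (smooth_p a) (smooth_phi_D a b su)); congr (_ * _ + _ * _).
  exact: (gt_act_field_base HM HN HE A z xi De oB (base_e De) (smooth_phi a b su)).
exact: (gt_act_field_pcoord HM HE A z xi a De).
Qed.

Variable B : fsect (@gt_fib R m p r M N G E) -> fsect (@gt_fib R m p r M N G E) ->
  fsect (@gt_fib R m p r M N G E).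
Hypothesis HB : is_gt_bracket B.

(** Brackets are local, so the global lifts may be replaced by their common
    expression over the domain of the local data. *)
Lemma gt_bracket_local X Y z w xi zeta e :
  smooth_sect (base_in_N c s t) z -> smooth_sect (base_in_N c s t) w ->
  (forall a, smooth_fun D (xi a)) -> (forall a, smooth_fun D (zeta a)) ->
  (forall q, D q -> X q = gt_field c s t z xi q) ->
  (forall q, D q -> Y q = gt_field c s t w zeta q) -> D e ->
  B X Y e = gt_field c s t (gbr z w) (fun a q =>
    gt_act (gt_field c s t z xi) (zeta a) q - gt_act (gt_field c s t w zeta) (xi a) q) e.
Proof.
move=> sz sw sx sy XE YE De.
have sF := gt_comb_sect HM HE A (gt_comb_field HM HN HE A sz sx).
have sG := gt_comb_sect HM HE A (gt_comb_field HM HN HE A sw sy).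
rewrite -(gt_bracket_field HM HN HE A HB sz sw sx sy De).
exact: (br_restr (gt_bracketP HB) oD (gt_sect_eq oD XE sF) sF (gt_sect_eq oD YE sG) sG).
Qed.

Let smooth_zero : smooth_sect (base_in_N c s t) (fun=> 0 : gF G _).
Proof. exact: smooth_sect0. Qed.

Let smooth_g u : smooth_sect setT u -> smooth_sect (base_in_N c s t) (gsec g u).
Proof.
by move=> su; apply: (smooth_gsec HM HN HE HF g oB); exact: sub_smooth_sect su.
Qed.

Lemma gbr_0l z y : smooth_sect (base_in_N c s t) z -> base_in_N c s t y ->
  gbr (fun=> 0) z y = 0.
Proof.
move=> sz Ny; have oN := mopen_base_in_N HM HE A.
rewrite (br_anti (gbrP G) oN smooth_zero sz Ny).
rewrite (br_0r (gbrP G) oN (S := smooth_sect (base_in_N c s t))) ?oppr0 //.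
by move=> z1 z2; exact: (smooth_sectD HN HF oN).
Qed.

Let anchor_0 (f : M -> R) x : smooth_fun Bs f -> Bs x ->
  tact (ganchor (0 : gF G (gh G x))) (fun y => f (dinv (gh G) y)) = 0.
Proof.
move=> sf Bx; apply: (ganchor0 G (mopen_dinv (h := gh G) oB)); first by rewrite /= dfunK.
exact: smooth_dinv.
Qed.

Let act_0_vlift xi u a e : smooth_sect setT u -> D e ->
  gt_act (gt_field c s t (fun=> 0) xi) (vlift_coef s u a) e = 0.
Proof.
move=> su De; rewrite gt_act_vlift_coef //.
have suB := sub_smooth_sect (@subsetT _ Bs) su.
exact: (anchor_0 (smooth_dual_comp a fs Bs_s suB) (base_e De)).
Qed.

Let act_0_clift xi u b e : smooth_sect setT u -> D e ->
  gt_act (gt_field c s t (fun=> 0) xi) (clift_coef s u b) e =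
  - \sum_a ebr_coef s u a b (dproj e) * xi a e.
Proof.
move=> su De; rewrite gt_act_clift_coef //; congr (- _); apply: eq_bigr => a _.
rewrite [X in _ * X + _](_ : _ = 0) ?mulr0 ?add0r //.
exact: (anchor_0 (smooth_phi a b su) (base_e De)).
Qed.

Lemma vlift_vlift u v e : smooth_sect setT u -> smooth_sect setT v -> D e ->
  B (vlift G u) (vlift G v) e = 0.
Proof.
move=> su sv De; have Bx := base_e De.
rewrite (gt_bracket_local smooth_zero smooth_zero (fun a => smooth_vlift_coef a su)
  (fun a => smooth_vlift_coef a sv) (fun q => vlift_field u A (e := q))
  (fun q => vlift_field v A (e := q)) De).
rewrite (@gt_field_eq c s t _ (fun=> 0) _ (fun _ _ => 0)) => [||a].
- rewrite /gt_field !big1 ?addr0 // => [a _|al _]; first exact: scale0r.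
  by rewrite /comp linear0 scale0r.
- by apply: gbr_0l => //; exact: base_in_N_proj.
- by rewrite !act_0_vlift // subrr.
Qed.

(** The vertical components are, up to sign, the Leibniz expansion of
    [ebr v u]. *)
Lemma vlift_clift u v e : smooth_sect setT u -> smooth_sect setT v -> D e ->
  B (vlift G u) (clift g v) e = vlift G (ebr u v) e.
Proof.
move=> su sv De; have Bx := base_e De.
have suB := sub_smooth_sect (@subsetT _ Bs) su.
have svB := sub_smooth_sect (@subsetT _ Bs) sv.
rewrite (gt_bracket_local smooth_zero (smooth_g sv) (fun a => smooth_vlift_coef a su)
  (fun a => smooth_clift_coef a sv) (fun q => vlift_field u A (e := q))
  (fun q => clift_field sv A (e := q)) De).
rewrite (vlift_field _ A De); apply: gt_field_eq => [|b].
  by apply: gbr_0l; [exact: smooth_g|exact: base_in_N_proj].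
rewrite act_0_clift // gt_act_vlift_coef // gsecE.
rewrite [RHS]/vlift_coef (br_anti ebrP oB suB svB Bx) -scaleN1r (compZ (E := dual E)) mulN1r.
rewrite (ebr_comp b oB fs Bs_s svB suB Bx) opprD; congr (- _ + _).
by apply: eq_bigr => a _; rewrite mulrC.
Qed.

(** The vertical components are the Jacobi identity [ebr_coef_bracket], summed
    against the fibre coordinates. *)
Lemma clift_clift u v e : smooth_sect setT u -> smooth_sect setT v -> D e ->
  B (clift g u) (clift g v) e = clift g (ebr u v) e.
Proof.
move=> su sv De; have Bx := base_e De.
have suB := sub_smooth_sect (@subsetT _ Bs) su.
have svB := sub_smooth_sect (@subsetT _ Bs) sv.
have suv := smooth_ebr (mopenT HM) su sv.
rewrite (gt_bracket_local (smooth_g su) (smooth_g sv) (fun a => smooth_clift_coef a su)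
  (fun a => smooth_clift_coef a sv) (fun q => clift_field su A (e := q))
  (fun q => clift_field sv A (e := q)) De).
rewrite (clift_field suv A De); apply: gt_field_eq => [|b].
  by rewrite [gsec g (ebr u v)](gsec_bracket HM HE HF Hg).
rewrite !gt_act_clift_coef // !gsecE {3}/clift_coef -opprD; congr (- _).
under [RHS]eq_bigr do rewrite (ebr_coef_bracket _ _ oB fs Bs_s suB svB Bx) mulrBr !mulrDr.
have key u' v' : \sum_a ebr_coef s v' a b (dproj e) * clift_coef s u' a e =
    - \sum_a pcoord s a e * \sum_d ebr_coef s u' a d (dproj e) * ebr_coef s v' d b (dproj e).
  under eq_bigr do rewrite mulrN mulr_sumr; rewrite sumrN exchange_big; congr (- _).
  apply: eq_bigr => a _; rewrite mulr_sumr; apply: eq_bigr => d _.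
  by rewrite mulrC mulrA.
rewrite big_split big_split /= !key [RHS]sumrB !big_split /= !opprD !opprK.
rewrite addrACA [RHS]addrACA [RHS]addrC; congr (_ + _); exact: addrC.
Qed.

End local_frame.

End lifts.

Theorem theorem33 (R : realType) (m p r : nat) (M N : charted R m)
  (HM : is_manifold M) (HN : is_manifold N)
  (G : gen_lie_algebroid p M N)
  (E : bundle M r) (HE : is_vector_bundle E)
  (g : bmorphism (gh G) (dual E) (gF G)) (Hg : locally_invertible g)
  (B : fsect (@gt_fib R m p r M N G E) -> fsect (@gt_fib R m p r M N G E) ->
       fsect (@gt_fib R m p r M N G E)) (HB : is_gt_bracket B)
  (u v : sect (dual E)) (Hu : smooth_sect setT u) (Hv : smooth_sect setT v) :
  let w := gsec_inv g (gbr (gsec g u) (gsec g v)) in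
  [/\ forall e, B (vlift G u) (vlift G v) e = 0,
      forall e, B (vlift G u) (clift g v) e = vlift G w e &
      forall e, B (clift g u) (clift g v) e = clift g w e].
Proof.
have aM := manifold_atlas HM; have aN := manifold_atlas HN.
split=> e; have [A De] := ref_admissible G HE e.
- exact: (vlift_vlift aM aN HE A HB Hu Hv De).
- exact: (vlift_clift aM aN HE Hg A HB Hu Hv De).
- exact: (clift_clift aM aN HE Hg A HB Hu Hv De).
Qed.
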